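(* Let $p$ be a prime, let $F=\langle x,y\mid x^p,y^p\rangle$ be the free product of two cyclic groups of order $p$, and let $n\geq 1$ be an integer. Then the $p$-central quotient $F/\lambda_n(F)$ is a Beauville group if and only if either $p\geq 5$ and $n\geq 2$, or $p=3$ and $n\geq 4$.
   Context: For a group $G$ and a prime $p$, the $p$-central series of $G$ is the series $G=\lambda_1(G)\geq \lambda_2(G)\geq\cdots$ defined by $\lambda_n(G)=[\lambda_{n-1}(G),G]\,\lambda_{n-1}(G)^p$ for $n>1$, where $H^p$ denotes the subgroup generated by all $p$-th powers of elements of $H$. The quotients $G/\lambda_n(G)$ are called the $p$-central quotients of $G$. For elements $x,y$ of a finite group $G$ put $$\Sigma(x,y)=\bigcup_{g\in G}\Big(\langle x\rangle^g\cup\langle y\rangle^g\cup\langle xy\rangle^g\Big),$$ where $H^g$ denotes the conjugate of $H$ by $g$. A finite group $G$ is a Beauville group if $G$ is a 2-generator group (i.e. its minimal number of generators is 2; in particular the trivial group is not a Beauville group) and there exist two generating sets $\{x_1,y_1\}$ and $\{x_2,y_2\}$ of $G$ such that $\Sigma(x_1,y_1)\cap\Sigma(x_2,y_2)=1$. *)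

(* Defs.v *)
From HB Require Import structures.
From mathcomp Require Import all_boot.
From mathcomp Require Import boolp classical_sets cardinality.

Set Implicit Arguments.
Unset Strict Implicit.
Unset Printing Implicit Defensive.

Local Open Scope quotient_scope.
Local Open Scope classical_set_scope.
Local Open Scope group_scope.

Section Subgroups.
Variable G : groupType.
Implicit Types (A H K : set G) (x y g : G).

Definition is_subgroup H : Prop := group_closed (mem H).

Definition gen A : set G := smallest is_subgroup A.

Definition generates A : Prop := gen A = setT.

Definition mul_set H K : set G := [set x * y | x in H & y in K].

Definition comm_subgroup H K : set G :=
  gen [set [~ x, y] | x in H & y in K].

Definition pow_subgroup (p : nat) H : set G := gen [set x ^+ p | x in H].

(* The index starts at 1: pcentral_set p 1 is the whole group, which is also
   the junk value at index 0. *)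
Definition pcentral_set (p n : nat) : set G :=
  iter n.-1 (fun H => mul_set (comm_subgroup H setT) (pow_subgroup p H)) setT.

Definition is_normal H : Prop :=
  is_subgroup H /\ forall x g, H x -> H (x ^ g).

Lemma subgroupP H : is_subgroup H <->
  H 1 /\ forall x y, H x -> H y -> H (x * y^-1).
Proof.
split=> [[H1 HB]|[H1 HB]]; split.
- by move: H1; rewrite inE.
- by move=> x y Hx Hy; have := HB x y; rewrite !inE; apply.
- by rewrite inE.
- by move=> x y; rewrite !inE; apply: HB.
Qed.

Lemma subgroup1 H : is_subgroup H -> H 1.
Proof. by case/subgroupP. Qed.

Lemma subgroupV H x : is_subgroup H -> H x -> H x^-1.
Proof. by case/subgroupP=> H1 HB Hx; rewrite -[x^-1]mul1g; apply: HB. Qed.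

Lemma subgroupM H x y : is_subgroup H -> H x -> H y -> H (x * y).
Proof.
move=> sH Hx Hy; rewrite -[y]invgK.
by case/subgroupP: (sH) => _; apply=> //; apply: subgroupV.
Qed.

Lemma subgroup_gen A : is_subgroup (gen A).
Proof.
apply/subgroupP; split=> [K [sK _]|x y gx gy K KA]; first exact: subgroup1.
by case/subgroupP: (KA.1) => _; apply; [apply: gx | apply: gy].
Qed.

Lemma normal_gen A : (forall x g, A x -> A (x ^ g)) -> is_normal (gen A).
Proof.
move=> nA; split=> [|x g gx K [sK AK]]; first exact: subgroup_gen.
apply: (gx [set y | K (y ^ g)]); split=> [|y Ay]; last exact/AK/nA.
apply/subgroupP; split=> [|y z Ky Kz] /=; first by rewrite conj1g; apply: subgroup1.
by rewrite conjMg conjVg; case/subgroupP: sK => _; apply.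
Qed.

Lemma normal_mul_set H K : is_normal H -> is_normal K ->
  is_normal (mul_set H K).
Proof.
move=> [sH nH] [sK nK]; split; first apply/subgroupP; first split.
- by exists 1; [apply: subgroup1 | exists 1; [apply: subgroup1 | rewrite mulg1]].
- move=> _ _ [x Hx [y Ky <-]] [z Hz [t Kt <-]].
  exists (x * z^-1); first by case/subgroupP: sH => _; apply.
  exists ((y * t^-1) ^ z^-1).
    by apply: nK; case/subgroupP: sK => _; apply.
  by rewrite /conjg invgK invgM !mulgA mulgVK.
- move=> _ g [x Hx [y Ky <-]]; rewrite conjMg.
  by exists (x ^ g); [apply: nH | exists (y ^ g); [apply: nK |]].
Qed.

Lemma normal_pcentral_set p n : is_normal (pcentral_set p n).
Proof.
rewrite /pcentral_set; elim: n.-1 => [|m [sH nH]] /=.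
  by split=> //; apply/subgroupP.
apply: normal_mul_set; apply: normal_gen.
- move=> _ g [x Hx [y _ <-]]; exists (x ^ g); first exact: nH.
  by exists (y ^ g) => //; rewrite conjRg.
- by move=> _ g [x Hx <-]; exists (x ^ g); [apply: nH | rewrite conjXg].
Qed.

End Subgroups.

Record normal_subgroup (G : groupType) := NormalSubgroup {
  normal_set : set G;
  normal_subgroupP : is_normal normal_set
}.

Definition pcentral (G : groupType) (p n : nat) : normal_subgroup G :=
  NormalSubgroup (@normal_pcentral_set G p n).

Section Quotient.
Variables (G : groupType) (N : normal_subgroup G).

Definition coset_rel (x y : G) : bool := `[< normal_set N (x^-1 * y) >].

Lemma coset_rel_equiv : equiv_class_of coset_rel.
Proof.
have [sN _] := normal_subgroupP N; split.
- by move=> x; apply/asboolP; rewrite mulVg; apply: subgroup1.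
- by move=> x y; apply/idP/idP => /asboolP/(subgroupV sN);
    rewrite invgM invgK => ?; apply/asboolP.
- move=> y x z /asboolP Nxy /asboolP Nyz; apply/asboolP.
  by have := subgroupM sN Nxy Nyz; rewrite mulgA mulgK.
Qed.

Canonical coset_equiv := EquivRelPack coset_rel_equiv.
Canonical coset_encModRel := defaultEncModRel coset_rel.

Definition quotient_group : Type := {eq_quot coset_rel}.
HB.instance Definition _ := Choice.on quotient_group.

Definition quotient_one : quotient_group := \pi_quotient_group 1.
Definition quotient_mul (a b : quotient_group) : quotient_group :=
  \pi_quotient_group (repr a * repr b).
Definition quotient_inv (a : quotient_group) : quotient_group :=
  \pi_quotient_group (repr a)^-1.

Lemma eq_coset x y :
  normal_set N (x^-1 * y) <-> \pi_quotient_group x = \pi_quotient_group y.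
Proof.
split=> [Nxy|/eqmodP/asboolP //]; exact/eqmodP/asboolP.
Qed.

Lemma repr_coset x : normal_set N ((repr (\pi_quotient_group x))^-1 * x).
Proof. by apply/eq_coset; rewrite reprK. Qed.

Lemma quotient_mulE x y :
  quotient_mul (\pi x) (\pi y) = \pi_quotient_group (x * y).
Proof.
have [sN nN] := normal_subgroupP N; apply/eq_coset.
have := subgroupM sN (nN _ (repr (\pi_quotient_group y)) (repr_coset x))
  (repr_coset y).
by rewrite /conjg invgM !mulgA mulgK.
Qed.

Lemma quotient_invE x : quotient_inv (\pi x) = \pi_quotient_group x^-1.
Proof.
have [sN nN] := normal_subgroupP N; apply/esym/eq_coset.
have := nN _ x^-1 (repr_coset x).
by rewrite /conjg invgK !mulgA mulgK.
Qed.

Lemma quotient_mulA : associative quotient_mul.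
Proof.
move=> a b c; rewrite -[a]reprK -[b]reprK -[c]reprK.
by rewrite !quotient_mulE mulgA.
Qed.

Lemma quotient_mul1g : left_id quotient_one quotient_mul.
Proof. by move=> a; rewrite -[a]reprK quotient_mulE mul1g. Qed.

Lemma quotient_mulg1 : right_id quotient_one quotient_mul.
Proof. by move=> a; rewrite -[a]reprK quotient_mulE mulg1. Qed.

Lemma quotient_mulVg : left_inverse quotient_one quotient_inv quotient_mul.
Proof. by move=> a; rewrite -[a]reprK quotient_invE quotient_mulE mulVg. Qed.

Lemma quotient_mulgV : right_inverse quotient_one quotient_inv quotient_mul.
Proof. by move=> a; rewrite -[a]reprK quotient_invE quotient_mulE mulgV. Qed.

HB.instance Definition _ := isGroup.Build quotient_group quotient_mulA
  quotient_mul1g quotient_mulg1 quotient_mulVg quotient_mulgV.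

End Quotient.

Section Presentation.
Variables (I : choiceType) (R : set (seq (I * bool))).

(* The letter (i, false) is the generator i and (i, true) its inverse. *)
Definition word := seq (I * bool).

Inductive word_eq : word -> word -> Prop :=
| WordRefl u : word_eq u u
| WordSym u v : word_eq u v -> word_eq v u
| WordTrans u v w : word_eq u v -> word_eq v w -> word_eq u w
| WordCat u u' v v' :
    word_eq u u' -> word_eq v v' -> word_eq (u ++ v) (u' ++ v')
| WordCancel i b : word_eq [:: (i, b); (i, ~~ b)] [::]
| WordRelator r : R r -> word_eq r [::].

Definition word_rel (u v : word) : bool := `[< word_eq u v >].

Lemma word_rel_equiv : equiv_class_of word_rel.
Proof.
split.
- by move=> u; apply/asboolP/WordRefl.
- by move=> u v; apply/idP/idP => /asboolP/WordSym ?; apply/asboolP.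
- by move=> v u w /asboolP uv /asboolP vw; apply/asboolP/(WordTrans uv).
Qed.

Canonical word_equiv := EquivRelPack word_rel_equiv.
Canonical word_encModRel := defaultEncModRel word_rel.

Definition presented_group : Type := {eq_quot word_rel}.
HB.instance Definition _ := Choice.on presented_group.

Definition inv_word (u : word) : word := rev [seq (a.1, ~~ a.2) | a <- u].

Definition presented_one : presented_group := \pi_presented_group [::].
Definition presented_mul (a b : presented_group) : presented_group :=
  \pi_presented_group (repr a ++ repr b).
Definition presented_inv (a : presented_group) : presented_group :=
  \pi_presented_group (inv_word (repr a)).

Lemma eq_presented u v :
  word_eq u v <-> \pi_presented_group u = \pi_presented_group v.
Proof.
split=> [Nxy|/eqmodP/asboolP //]; exact/eqmodP/asboolP.
Qed.

Lemma repr_presented u : word_eq (repr (\pi_presented_group u)) u.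
Proof. by apply/eq_presented; rewrite reprK. Qed.

Lemma presented_mulE u v :
  presented_mul (\pi u) (\pi v) = \pi_presented_group (u ++ v).
Proof. by apply/eq_presented/WordCat; apply: repr_presented. Qed.

Lemma inv_word_cat u v : inv_word (u ++ v) = inv_word v ++ inv_word u.
Proof. by rewrite /inv_word map_cat rev_cat. Qed.

Lemma inv_wordK : involutive inv_word.
Proof.
move=> u; rewrite /inv_word map_rev revK -map_comp -[RHS]map_id.
by apply: eq_map => -[i b] /=; rewrite negbK.
Qed.

Lemma word_mulV u : word_eq (u ++ inv_word u) [::].
Proof.
elim: u => [|[i b] u IHu]; first exact: WordRefl.
rewrite -cat1s inv_word_cat -catA [u ++ _]catA.
apply: WordTrans (WordCancel i b); apply: (WordCat (WordRefl [:: (i, b)])).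
exact: (WordCat IHu (WordRefl [:: (i, ~~ b)])).
Qed.

Lemma word_Vmul u : word_eq (inv_word u ++ u) [::].
Proof. by have := word_mulV (inv_word u); rewrite inv_wordK. Qed.

Lemma word_inv u v : word_eq u v -> word_eq (inv_word u) (inv_word v).
Proof.
move=> uv; apply: (@WordTrans _ (inv_word u ++ (v ++ inv_word v))).
  have := WordCat (WordRefl (inv_word u)) (WordSym (word_mulV v)).
  by rewrite cats0.
rewrite catA; apply: (WordCat (u' := [::]) _ (WordRefl (inv_word v))).
apply: WordTrans (word_Vmul u).
exact: (WordCat (WordRefl (inv_word u)) (WordSym uv)).
Qed.

Lemma presented_invE u :
  presented_inv (\pi u) = \pi_presented_group (inv_word u).
Proof. by apply/eq_presented/word_inv/repr_presented. Qed.

Lemma presented_mulA : associative presented_mul.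
Proof.
move=> a b c; rewrite -[a]reprK -[b]reprK -[c]reprK.
by rewrite !presented_mulE catA.
Qed.

Lemma presented_mul1g : left_id presented_one presented_mul.
Proof. by move=> a; rewrite -[a]reprK presented_mulE. Qed.

Lemma presented_mulg1 : right_id presented_one presented_mul.
Proof. by move=> a; rewrite -[a]reprK presented_mulE cats0. Qed.

Lemma presented_mulVg : left_inverse presented_one presented_inv presented_mul.
Proof.
move=> a; rewrite -[a]reprK presented_invE presented_mulE.
exact/eq_presented/word_Vmul.
Qed.

Lemma presented_mulgV :
  right_inverse presented_one presented_inv presented_mul.
Proof.
move=> a; rewrite -[a]reprK presented_invE presented_mulE.
exact/eq_presented/word_mulV.
Qed.

HB.instance Definition _ := isGroup.Build presented_group presented_mulA
  presented_mul1g presented_mulg1 presented_mulVg presented_mulgV.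

End Presentation.

(* < x, y | x^p, y^p >, with x and y the generators true and false. *)
Definition free_product_cyclic (p : nat) : groupType :=
  presented_group [set nseq p (b, false) | b in [set: bool]].

Section Beauville.
Variable G : groupType.

(* Repetitions in s are harmless, since the size is minimised. *)
Definition min_generators (d : nat) : Prop :=
  (exists s : seq G, size s = d /\ generates [set` s]) /\
  (forall s : seq G, generates [set` s] -> d <= size s).

Definition conj_set (H : set G) (g : G) : set G := [set h ^ g | h in H].

Definition Sigma (x y : G) : set G :=
  \bigcup_(g in [set: G]) (conj_set (gen [set x]) g
    `|` conj_set (gen [set y]) g `|` conj_set (gen [set x * y]) g).

Definition beauville : Prop :=
  [/\ finite_set [set: G], min_generators 2 &
      exists x1 y1 x2 y2 : G,
        [/\ generates [set x1; y1], generates [set x2; y2] &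
            Sigma x1 y1 `&` Sigma x2 y2 = [set 1]]].

End Beauville.

(* Main.v *)
Require Import Defs.
From HB Require Import structures.
From mathcomp Require Import all_boot all_order all_algebra.
From mathcomp Require Import perm zify ring.
From mathcomp Require Import boolp classical_sets cardinality.

(* Write X and Y for the images of x and y in G = F / lambda_n(F). Since F is
   generated by elements of order p, a Hall-Petrescu argument shows that p-th
   powers raise the lower central weight by p - 1; hence z ^ (p ^ m) = 1 in G
   as soon as m (p - 1) >= n - 1. This bound on the order of X Y is sharp, even
   after mapping F to Z[zeta] : C_p, zeta a primitive p-th root of unity, with
   X acting as zeta^-1, Y as zeta (times translations) and X Y a translation by
   a unit: the image of (X Y) ^ i being trivial modulo (1 - zeta) ^ (n - 1)
   forces p ^ (n - 1) to divide i ^ (p - 1) by taking norms. All elements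
   outside the translation subgroup have order p there, so no nontrivial power
   of X Y is conjugate to a power of an element whose image in F / F' is not
   parallel to that of X Y. For X and Y, which have order p, this is seen
   already in F / F'. Hence (X, Y) and (X Y^2, X Y^4) form a Beauville structure
   when p >= 5. For p = 3 the triple (X, Y, X Y) necessarily shares directions
   with any other one, and one takes (Y (X Y)^2, Y (X Y)^3), distinguishing
   Y (X Y)^2 from the conjugates of powers of X, and Y (X Y)^3 from those of Y,
   in the wreath product C_3 wr C_3, of class 3: this needs n >= 4. Conversely,
   if p = 2 or p = 3 and n <= 3, elements of G with the same nonzero image in
   F / F' tend to be conjugate, and two generating triples always share a
   direction. *)

Set Implicit Arguments.
Unset Strict Implicit.
Unset Printing Implicit Defensive.

Local Open Scope quotient_scope.
Local Open Scope classical_set_scope.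
Local Open Scope group_scope.

(** * Lower central series *)

Section GroupIdentities.
Variable G : groupType.
Implicit Types x y z : G.

Lemma conjg_mulR x y : x ^ y = x * [~ x, y].
Proof. by rewrite commgEl mulVKg. Qed.

Lemma commMgJ x y z : [~ x * y, z] = [~ x, z] ^ y * [~ y, z].
Proof. by rewrite !commgEr conjgM mulgA -conjMg mulgK. Qed.

Lemma commgMJ x y z : [~ x, y * z] = [~ x, z] * [~ x, y] ^ z.
Proof. by rewrite !commgEl conjgM -mulgA -conjMg mulVKg. Qed.

Lemma commVgJ x y : [~ x^-1, y] = ([~ x, y]^-1) ^ x^-1.
Proof. by rewrite /commg /conjg !gnorm. Qed.

Lemma commgVJ x y : [~ x, y^-1] = ([~ x, y]^-1) ^ y^-1.
Proof. by rewrite /commg /conjg !gnorm. Qed.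

Lemma Hall_Witt_identity x y z :
  [~ x, y^-1, z] ^ y * [~ y, z^-1, x] ^ z * [~ z, x^-1, y] ^ x = 1.
Proof.
(* Each of the three factors is a quotient of values of [a] at cyclically shifted arguments, so the
   product telescopes. *)
pose a x y z : G := x * z * y ^ x.
suffices{x y z} hw_aux x y z: [~ x, y^-1, z] ^ y = (a x y z)^-1 * (a y z x).
  by rewrite !hw_aux; move: a {hw_aux} => a; rewrite 2!mulgA !mulgK mulVg.
by rewrite /a /commg /conjg !gnorm.
Qed.

End GroupIdentities.

Section Generation.
Variable G : groupType.
Implicit Types (A H K : set G) (x y g : G).

Lemma sub_gen A x : A x -> gen A x.
Proof. by move=> Ax K [_]; apply. Qed.

Lemma gen_subP A H : is_subgroup H -> (forall x, A x -> H x) ->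
  forall x, gen A x -> H x.
Proof. by move=> sH AH x; apply; split. Qed.

Lemma subgroupX H x n : is_subgroup H -> H x -> H (x ^+ n).
Proof.
move=> sH Hx; elim: n => [|n IHn]; first exact: subgroup1.
by rewrite expgS; apply: subgroupM.
Qed.

Lemma subgroupC H x y : is_subgroup H -> H x -> (H (x * y) <-> H y).
Proof.
move=> sH Hx; split=> [Hxy|]; last exact: subgroupM.
by rewrite -(mulKg x y); apply: subgroupM => //; apply: subgroupV.
Qed.

Lemma subgroupCr H x y : is_subgroup H -> H y -> (H (x * y) <-> H x).
Proof.
move=> sH Hy; split=> [Hxy|Hx]; last exact: subgroupM.
by rewrite -(mulgK y x); apply: subgroupM => //; apply: subgroupV.
Qed.

Lemma generates_ind A H : generates A -> is_subgroup H ->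
  (forall x, A x -> H x) -> forall x, H x.
Proof. by move=> gA sH AH x; apply: (gen_subP sH AH); rewrite gA. Qed.

Lemma normalR H x y : is_normal H -> H x -> H [~ x, y].
Proof.
by move=> [sH nH] Hx; rewrite commgEl; apply: subgroupM (nH _ _ Hx) => //;
  apply: subgroupV.
Qed.

End Generation.

Section LowerCentralSeries.
Variable G : groupType.
Implicit Types (x y z g : G) (s i j : nat).

(* Indexed from 0: this is the usual gamma_(s.+1). *)
Definition lcs s : set G :=
  iter s (fun H => comm_subgroup H setT) setT.

Lemma lcs_normal s : is_normal (lcs s).
Proof.
elim: s => [|s [sL nL]] /=; first by split=> //; apply/subgroupP.
apply: normal_gen => _ g [x Lx [y _ <-]]; exists (x ^ g); first exact: nL.
by exists (y ^ g) => //; rewrite conjRg.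
Qed.

Lemma lcs_subgroup s : is_subgroup (lcs s).
Proof. by case: (lcs_normal s). Qed.

Lemma lcsJ s x g : lcs s x -> lcs s (x ^ g).
Proof. by case: (lcs_normal s) => _; apply. Qed.

Lemma lcsS_R s x g : lcs s x -> lcs s.+1 [~ x, g].
Proof. by move=> Lx; apply: sub_gen; exists x => //; exists g. Qed.

Lemma lcsS_ind s (H : set G) : is_subgroup H ->
  (forall x g, lcs s x -> H [~ x, g]) -> forall x, lcs s.+1 x -> H x.
Proof. by move=> sH HR; apply: gen_subP => // _ [x Lx [g _ <-]]; apply: HR. Qed.

Lemma lcs_leq i j x : i <= j -> lcs j x -> lcs i x.
Proof.
move/subnK=> <-; elim: (j - i) x => [//|k IHk] x.
rewrite addSn; apply: lcsS_ind => [|y g Ly]; first exact: lcs_subgroup.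
by apply: normalR; [apply: lcs_normal | apply: IHk].
Qed.

Lemma subgroup_centralizer_mod (K : set G) x : is_normal K ->
  is_subgroup [set y | K [~ x, y]].
Proof.
move=> [sK nK]; apply/subgroupP; split=> [|y z Ky Kz] /=.
  by rewrite commg1; apply: subgroup1.
rewrite commgMJ; apply: subgroupM => //; last exact: nK.
by rewrite commgVJ; apply: nK; apply: subgroupV.
Qed.

(** A three subgroups argument by induction on [j]: the [y] with [[~ x, y]] in the target form a
    subgroup, so only commutators [[~ y, g]] matter. For these, two of the three Hall-Witt factors
    lie in the target, hence so does the third. The shift [.+1] comes from indexing [lcs] from 0. *)
Lemma lcs_commutator i j x y :
  lcs i x -> lcs j y -> lcs (i + j).+1 [~ x, y].
Proof.
elim: j i x y => [|j IHj] i x y Lx; first by rewrite addn0 => _; apply: lcsS_R.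
have [sK nK] := lcs_normal (i + j.+1).+1.
move: y; apply: lcsS_ind => [|y g Ly].
  exact: subgroup_centralizer_mod.
have LV s (z : G) : lcs s z -> lcs s z^-1 := @subgroupV _ _ _ (lcs_subgroup s).
have := Hall_Witt_identity x y g^-1; rewrite invgK => hw.
have K1: lcs (i + j.+1).+1 [~ x, y^-1, g^-1].
  rewrite addnS; apply: lcsS_R; apply: IHj => //. exact: LV.
have K3: lcs (i + j.+1).+1 [~ g^-1, x^-1, y].
  rewrite addnS -addSn; apply: IHj => //; rewrite -invgR; apply: (LV).
  by apply: lcsS_R; apply: (LV).
have K2: lcs (i + j.+1).+1 ([~ y, g, x] ^ g^-1).
  apply/(subgroupC _ sK (nK _ y K1))/(subgroupCr _ sK (nK _ x K3)).
  by rewrite hw; apply: subgroup1.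
by rewrite -invgR; apply: (LV); rewrite -(conjgK g^-1 [~ _, x]); apply: nK.
Qed.

End LowerCentralSeries.

(** * Powers in the lower central series *)

Section PolynomialSequences.
Variables (G : groupType) (M : nat -> set G).
Hypothesis sM : forall d, is_subgroup (M d).
Hypothesis M_leq : forall i j x, i <= j -> M j x -> M i x.
Hypothesis MR : forall i j x y, M i x -> M j y -> M (i + j) [~ x, y].
Implicit Types (f g h : nat -> G) (d i j k m n : nat).

Definition diffg f n : G := (f n)^-1 * f n.+1.

(* Polynomial sequences in the sense of Leibman: the j-th differences of f lie
   in M (d + j). Truncating at j <= k makes the closure properties provable by
   induction on k. *)
Fixpoint polyseq k d f : Prop :=
  (forall n, M d (f n)) /\ (if k is k'.+1 then polyseq k' d.+1 (diffg f) else True).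

Lemma polyseq_val k d f n : polyseq k d f -> M d (f n).
Proof. by case: k => [|k] [Mf _]. Qed.

Lemma polyseqW k d f : polyseq k.+1 d f -> polyseq k d f.
Proof.
elim: k d f => [|k IHk] d f [Mf Df]; split=> //; exact: IHk.
Qed.

Lemma polyseq_leq k i j f : i <= j -> polyseq k j f -> polyseq k i f.
Proof.
elim: k i j f => [|k IHk] i j f le_ij [Mf Df]; split=> //;
  by [move=> n; exact: M_leq (Mf n) | exact: IHk Df].
Qed.

Lemma eq_polyseq k d f g : f =1 g -> polyseq k d f -> polyseq k d g.
Proof. by move=> /funext ->. Qed.

(** The three closures need each other: differences of products, inverses and commutators expand
    into conjugates and commutators of the sequences and their differences, and conjugation is
    multiplication by a commutator. *)
Lemma polyseq_closed k :
  [/\ forall d f g, polyseq k d f -> polyseq k d g ->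
        polyseq k d (fun n => f n * g n),
      forall d f, polyseq k d f -> polyseq k d (fun n => (f n)^-1) &
      forall i j f g, polyseq k i f -> polyseq k j g ->
        polyseq k (i + j) (fun n => [~ f n, g n])].
Proof.
elim: k => [|k [Pmul Pinv Pcomm]].
  split=> [d f g [Mf _] [Mg _]|d f [Mf _]|i j f g [Mf _] [Mg _]];
    split=> // n; [exact: subgroupM | exact: subgroupV | exact: MR].
have PJ i j f g : polyseq k i f -> polyseq k j g ->
    polyseq k i (fun n => f n ^ g n).
  move=> Pf Pg; apply: (@eq_polyseq _ _ (fun n => f n * [~ f n, g n])).
    by move=> n; rewrite conjg_mulR.
  by apply: Pmul => //; apply: polyseq_leq (Pcomm _ _ _ _ Pf Pg); apply: leq_addr.
split=> [d f g Pf Pg|d f Pf|i j f g Pf Pg].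
- split=> [n|].
    by apply: subgroupM; [| exact: polyseq_val Pf | exact: polyseq_val Pg].
  apply: (@eq_polyseq _ _ (fun n => diffg f n ^ g n * diffg g n)).
    by move=> n; rewrite /diffg /conjg !gnorm.
  by apply: Pmul; [apply: PJ (polyseqW Pg); case: Pf | case: Pg].
- split=> [n|]; first by apply: subgroupV => //; exact: polyseq_val Pf.
  apply: (@eq_polyseq _ _ (fun n => ((diffg f n)^-1) ^ (f n)^-1)).
    by move=> n; rewrite /diffg /conjg !gnorm.
  by apply: PJ (Pinv _ _ (polyseqW Pf)); apply: Pinv; case: Pf.
split=> [n|]; first by apply: MR; [exact: polyseq_val Pf | exact: polyseq_val Pg].
pose c n := [~ f n, g n]; pose F := diffg f; pose H := diffg g.
have [Pf0 Pg0] := (polyseqW Pf, polyseqW Pg).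
have PF : polyseq k i.+1 F by case: Pf.
have PH : polyseq k j.+1 H by case: Pg.
have Pc : polyseq k (i + j) c by apply: Pcomm.
(* This is the difference of [c], expanded along [f n.+1 = f n * F n] and [g n.+1 = g n * H n].
   Every factor involves [F] or [H], so its weight is at least [i + j + 1]. *)
apply: (@eq_polyseq _ _ (fun n =>
    ([~ f n, H n] ^ F n) ^ c n * ([~ c n, F n] * [~ c n, H n] ^ F n)
      * ([~ F n, H n] * [~ F n, g n] ^ H n))).
  move=> n; have E (u : nat -> G) : u n.+1 = u n * diffg u n by rewrite mulVKg.
  rewrite -!commgMJ /diffg /c (E f) (E g) -/F -/H.
  rewrite [[~ f n * F n, _]]commMgJ [[~ f n, g n * H n]]commgMJ.
  move: (F n) (H n) [~ f n, H n] [~ f n, g n] [~ F n, _] => u v a b w.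
  by rewrite /commg /conjg !gnorm.
have Pl l u : i + j < l -> polyseq k l u -> polyseq k (i + j).+1 u.
  by move=> ltl; apply: polyseq_leq.
apply: (Pmul _ _ (fun n => [~ F n, H n] * _)).
  apply: (Pmul _ _ (fun n => [~ c n, F n] * _)).
- apply: (PJ _ _ _ _ _ Pc); apply: (PJ _ _ _ _ _ PF).
  by rewrite -addnS; exact: Pcomm.
- apply: (Pmul); first by apply: (Pl (i + j + i.+1)); [lia | exact: Pcomm].
  by apply: (PJ _ _ _ _ _ PF); apply: (Pl (i + j + j.+1)); [lia | exact: Pcomm].
- apply: (Pmul); first by apply: (Pl (i.+1 + j.+1)); [lia | exact: Pcomm].
  by apply: (PJ _ _ _ _ _ PH); rewrite -addSn; exact: Pcomm.
Qed.
Lemma polyseq1 k d : polyseq k d (fun=> 1).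
Proof.
elim: k d => [|k IHk] d; (split; first by move=> n; apply: subgroup1) => //.
by apply: (eq_polyseq _ (IHk d.+1)) => n; rewrite /diffg invg1 mulg1.
Qed.

(** By Pascal's rule the difference of [c ^+ 'C(n, j.+1)] is [c ^+ 'C(n, j)]. *)
Lemma polyseq_bin k d j c :
  M (d + j) c -> polyseq k d (fun n => c ^+ 'C(n, j)).
Proof.
have val e i n : M (e + i) c -> M e (c ^+ 'C(n, i)).
  by move=> Mc; apply: subgroupX => //; apply: M_leq Mc; apply: leq_addr.
elim: k d j => [|k IHk] d [|j] Mc; (split; first by move=> n; exact: val Mc) => //.
  apply: (eq_polyseq _ (polyseq1 k d.+1)) => n.
  by rewrite /diffg !bin0 mulVg.
apply: (@eq_polyseq _ _ (fun n => c ^+ 'C(n, j))).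
  by move=> n; rewrite /diffg binS expgnDr mulKg.
by apply: IHk; rewrite addSnnS.
Qed.

(** When [f] is trivial before [m], its value at [m] is its [m]-th difference at 0. *)
Lemma polyseq_taylor k d m f : polyseq k d f -> m <= k ->
  (forall j, j < m -> f j = 1) -> M (d + m) (f m).
Proof.
elim: m k d f => [|m IHm] k d f Pf le_mk f1.
  by rewrite addn0; apply: polyseq_val Pf.
case: k Pf le_mk => // k [_ Df] le_mk.
have -> : f m.+1 = diffg f m by rewrite /diffg (f1 m) // invg1 mul1g.
rewrite addnS -addSn; apply: IHm Df le_mk _ => j lt_jm.
by rewrite /diffg !f1 ?mulVg // ltnW.
Qed.

(* f p is a product of c_m ^ 'C(p, m) with c_m in M m, and p divides the
   binomial coefficients with 1 < m < p. *)
Lemma polyseq_prime p (B : set G) f : prime p -> is_subgroup B ->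
    (forall c, M 2 c -> B (c ^+ p)) -> (forall c, M p c -> B c) ->
  polyseq p 0 f -> f 0 = 1 -> B ((f 1%N) ^- p * f p).
Proof.
move=> p_pr sB B2 Bp Pf f0; have p_gt1 := prime_gt1 p_pr.
(* [h] is what remains of [f] once its Taylor factors are divided off on the left, one degree at a
   time. The element required to lie in [B] is the product of the removed factors of degree above 1,
   evaluated at [p]. *)
suffices [h [Ph h1 Bh]]: exists h, [/\ polyseq p 0 h,
    forall j, j < p -> h j = 1 & B ((f 1%N) ^- p * f p * (h p)^-1)].
  apply: (iffLR (subgroupCr _ sB _) Bh); apply: subgroupV => //; apply: Bp.
  exact: (polyseq_taylor Ph (leqnn p) h1).
have [Pmul Pinv _] := polyseq_closed p.
have PX c j : M j c -> polyseq p 0 (fun n => (c ^+ 'C(n, j))^-1).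
  by move=> Mc; apply: (Pinv); apply: polyseq_bin.
rewrite -{2}(subnKC p_gt1); have: (p - 2).+2 <= p by rewrite -addn2 subnK.
elim: (p - 2) => [_|i IHi lt_ip].
  exists (fun n => (f 1%N ^+ 'C(n, 1))^-1 * f n); split.
  - apply: (Pmul _ (fun n => (f 1%N ^+ 'C(n, 1))^-1)) => //; apply: (PX).
    apply: (polyseq_taylor Pf (ltnW p_gt1)) => j; by case: j.
  - by case=> [|[|j]] // _; rewrite ?bin0n ?bin1 ?f0 ?mulg1 ?invg1 ?mulVg.
  - by rewrite bin1 mulgV; apply: subgroup1.
have [h [Ph h1 Bh]] := IHi (ltnW lt_ip); pose m := i.+2.
have Mc : M m (h m) := polyseq_taylor Ph (ltnW lt_ip) h1.
exists (fun n => (h m ^+ 'C(n, m))^-1 * h n); split.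
- by apply: (Pmul _ (fun n => (h m ^+ 'C(n, m))^-1)) => //; apply: (PX).
- move=> j; rewrite [_ < _]ltnS leq_eqVlt => /orP[/eqP ->|lt_jm].
    by rewrite binn expg1 mulVg.
  by rewrite bin_small // (h1 j) // invg1 mulg1.
rewrite invgM invgK mulgA; apply: subgroupM => //.
have /dvdnP[q ->] : p %| 'C(p, m) by apply: prime_dvd_bin.
rewrite mulnC expgnA; apply: subgroupX => //; apply: B2.
by apply: M_leq Mc.
Qed.

End PolynomialSequences.

(** A Hall-Petrescu formula: [(u * x) ^+ n * x ^- n] has difference [u ^ (x ^- n)], so it is
    polynomial for the lower central series shifted to have [lcs s] in degrees 0 and 1, and
    [polyseq_prime] applies. *)
Lemma lcs_expgM (G : groupType) p s (u x : G) : prime p -> lcs s u ->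
    (forall c : G, lcs s.+1 c -> lcs (s + p.-1) (c ^+ p)) ->
  lcs (s + p.-1) (u ^- p * ((u * x) ^+ p * x ^- p)).
Proof.
move=> p_pr Lu Lp; pose M d := @lcs G (s + d.-1).
have sM d : is_subgroup (M d) by apply: lcs_subgroup.
have M_leq i j z : i <= j -> M j z -> M i z by move=> le_ij; apply: lcs_leq; lia.
have MR i j z w : M i z -> M j w -> M (i + j) [~ z, w].
  by move=> Mz Mw; apply: lcs_leq (lcs_commutator Mz Mw); lia.
have Pconj k d c : M d.+1 c -> polyseq M k d.+1 (fun n => c ^ (x ^- n)).
  elim: k d c => [|k IHk] d c Mc; (split; first by move=> n; exact: lcsJ) => //.
  apply: (@eq_polyseq _ _ _ _ (fun n => [~ c, x^-1] ^ (x ^- n))).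
    by move=> n; rewrite /diffg expgSr /commg /conjg !gnorm.
  by apply: (IHk); rewrite /M /= addnS; apply: lcsS_R.
pose f n := (u * x) ^+ n * x ^- n.
have Df n : diffg f n = u ^ (x ^- n).
  by rewrite /diffg /f !expgSr /conjg !gnorm.
have Pf k : polyseq M k 0 f.
  apply: polyseqW; split=> [n|]; last first.
    apply: (eq_polyseq (fun n => esym (Df n))); apply: Pconj.
    by rewrite /M addn0.
  rewrite /M addn0; elim: n => [|n IHn].
    rewrite /f !expg0 invg1 mulg1; exact: (subgroup1 (lcs_subgroup _ _)).
  have -> : f n.+1 = f n * diffg f n by rewrite mulVKg.
  by apply: subgroupM => //; [apply: lcs_subgroup | rewrite Df; apply: lcsJ].
have := @polyseq_prime _ M sM M_leq MR p (lcs (s + p.-1)) f p_pr.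
rewrite /f /= expg1 mulgK; apply=> //; first exact: lcs_subgroup.
  by move=> c; rewrite /M /= addn1; apply: Lp.
by rewrite invg1 mulg1.
Qed.

Section OrderPGenerators.
Variables (G : groupType) (p c : nat) (x y : G).
Implicit Types u v w a d g h : G.
Hypothesis p_pr : prime p.
Hypothesis gen_xy : generates [set x; y].
Hypotheses (xp : x ^+ p = 1) (yp : y ^+ p = 1).
Hypothesis lcs_triv : forall z : G, lcs c z -> z = 1.

(** Descending induction on the weight, started by nilpotency. By [lcs_expgM] the elements of
    [lcs t] with the required [p]-th power form a normal subgroup [S], so generators suffice: [x]
    and [y], or commutators. *)
Lemma lcs_expp s (z : G) : lcs s z -> lcs (s + p.-1) (z ^+ p).
Proof.
suffices main k t (w : G) : c <= t + k -> lcs t w -> lcs (t + p.-1) (w ^+ p).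
  by apply: (main c); apply: leq_addl.
elim: k t w => [|k IHk] t w.
  rewrite addn0 => le_ct Lw; rewrite (lcs_triv (lcs_leq le_ct Lw)) expg1n.
  by apply: subgroup1; apply: lcs_subgroup.
rewrite -addSnnS => le_ck; have Lp u := IHk t.+1 u le_ck.
have {}Lp u : lcs t.+1 u -> lcs (t + p).+1.-1 (u ^+ p).
  by move=> Lu; apply: lcs_leq (Lp _ Lu); have := prime_gt0 p_pr; lia.
have {}Lp u v : lcs t u -> lcs (t + p.-1) (u ^- p * ((u * v) ^+ p * v ^- p)).
  move=> Lu; apply: lcs_expgM => // d /Lp Ld; apply: lcs_leq Ld.
  by have := prime_gt0 p_pr; lia.
have [sB nB] := @lcs_normal G (t + p.-1); have sL := @lcs_subgroup G t.
pose S : set G := [set u | lcs t u /\ lcs (t + p.-1) (u ^+ p)].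
have SM u v : S u -> S v -> S (u * v).
  move=> [Lu Bu] [Lv Bv]; split; first exact: subgroupM.
  apply/(subgroupCr _ sB (subgroupV sB Bv)).
  by apply/(subgroupC _ sB (subgroupV sB Bu)); apply: Lp.
have SV u : S u -> S u^-1.
  by move=> [Lu Bu]; split; rewrite ?expVgn; apply: subgroupV.
have SJ u g : S u -> S (u ^ g).
  by move=> [Lu Bu]; split; rewrite -?conjXg; [apply: lcsJ | apply: nB].
have S1 : S 1 by split; rewrite ?expg1n; apply: subgroup1.
have sS : is_subgroup S by apply/subgroupP; split=> // u v Su Sv; apply/SM/SV.
suffices: lcs t w -> S w by move=> LS /LS[].
case: t {le_ck sB nB} @S Lp sL SM SV SJ S1 sS => [|t] S Lp sL SM SV SJ S1 sS.
  move=> _; apply: (generates_ind gen_xy sS) => _ [] ->; split=> //;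
    by rewrite ?xp ?yp; (apply: subgroup1; apply: lcs_subgroup).
move: w; apply: lcsS_ind => // a g La; move: g a La.
(* [C] is a subgroup, which reduces [[~ a, g]] to the case where [g] is [x] or [y]. *)
pose C : set G := [set g | forall a : G, lcs t a -> S [~ a, g]].
suffices: forall g, C g by [].
apply: (generates_ind gen_xy).
  apply/subgroupP; split=> [a La|g h Cg Ch a La]; first by rewrite commg1.
  rewrite commgMJ; apply: SM; last exact/SJ/Cg.
  by rewrite commgVJ; apply/SJ/SV/Ch.
move=> g gxy a La; split; first exact: lcsS_R.
have gp : g ^+ p = 1 by case: gxy => ->.
have sB := @lcs_subgroup G (t.+1 + p.-1).
have := Lp [~ a, g] g^-1 (lcsS_R g La).
(* Both this conjugate and [g^-1] have trivial [p]-th power, so the formula leaves only the [p]-th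
   power of [[~ a, g]]. *)
have -> : [~ a, g] * g^-1 = g^-1 ^ a by rewrite /commg /conjg !gnorm.
rewrite -conjXg expVgn gp !(invg1, conj1g, mulg1) => /(subgroupV sB).
by rewrite invgK.
Qed.

End OrderPGenerators.

(** * Quotients and finiteness *)

Section Coset.
Variables (G : groupType) (N : normal_subgroup G).

Definition coset (x : G) : quotient_group N := \pi x.

Lemma coset_morphism : monoid_morphism coset.
Proof. by split=> // x y; rewrite /coset -quotient_mulE. Qed.

HB.instance Definition _ :=
  isUMagmaMorphism.Build G (quotient_group N) coset coset_morphism.

Lemma coset_eqP x y : coset x = coset y <-> normal_set N (x^-1 * y).
Proof. by split=> /eq_coset. Qed.

Lemma coset_eq1 x : coset x = 1 <-> normal_set N x.
Proof.
by have := coset_eqP 1 x; rewrite invg1 mul1g gmulf1 => <-; split=> ->.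
Qed.

Lemma coset_repr a : coset (repr a) = a.
Proof. exact: reprK. Qed.

End Coset.

Section Morphism.
Variables (G H : groupType) (f : UMagmaMorphism.type G H).

Lemma subgroup_preimage (K : set H) : is_subgroup K -> is_subgroup (f @^-1` K).
Proof.
move=> sK; apply/subgroupP; split=> [|x y Kx Ky]; rewrite /preimage /=.
  by rewrite gmulf1; apply: subgroup1.
by rewrite gmulfF; case/subgroupP: sK => _; apply.
Qed.

Lemma gen_morph (A : set G) x : gen A x -> gen (f @` A) (f x).
Proof.
move: x; apply: gen_subP; first exact/subgroup_preimage/subgroup_gen.
by move=> x Ax; apply: sub_gen; exists x.
Qed.

End Morphism.

Section FiniteExponent.
Variables (G : groupType) (p : nat).
Hypothesis p_gt0 : 0 < p.
Implicit Types (x y z : G) (Y : seq G).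

Lemma expg_modp x k : x ^+ p = 1 -> x ^+ (k %% p) = x ^+ k.
Proof.
by move=> xp; rewrite [in RHS](divn_eq k p) expgnDr mulnC expgnA xp expg1n mul1g.
Qed.

Lemma expg_predp x k : x ^+ p = 1 -> x ^+ (p.-1 * k) = x ^- k.
Proof.
move=> xp; rewrite -expVgn expgnA; congr (_ ^+ k).
by apply/(mulgI x); rewrite -expgS prednK // mulgV.
Qed.

(** The inverse of a generator of order dividing [p] is a positive power of it, so left
    multiplication by generators suffices. *)
Lemma generates_ind_mul (x y : G) (H : set G) : generates [set x; y] ->
    x ^+ p = 1 -> y ^+ p = 1 -> H 1 ->
    (forall z, H z -> H (x * z)) -> (forall z, H z -> H (y * z)) ->
  forall z, H z.
Proof.
move=> gxy xp yp H1 Hx Hy z.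
pose C : set G := [set g | forall z, H z -> H (g * z) /\ H (g^-1 * z)].
suffices /(_ 1 H1) : C z by rewrite mulg1 => -[].
move: z {H1}; apply: (generates_ind gxy).
  apply/subgroupP; split=> [z Hz|g h Cg Ch z Hz]; first by rewrite invg1 mul1g.
  rewrite invgM invgK -!mulgA; split; first by apply Cg; apply Ch.
  by apply Ch; apply Cg.
have Cgen g : g ^+ p = 1 -> (forall z, H z -> H (g * z)) -> C g.
  move=> gp Hg z Hz; split; first exact: Hg.
  rewrite -(expg1 g) -expg_predp // muln1.
  elim: p.-1 => [|k IHk]; first by rewrite mul1g.
  by rewrite expgS -mulgA; apply: Hg.
by move=> _ [] ->; apply: Cgen.
Qed.

Fixpoint power_products Y : seq G :=
  if Y is y :: Y' then
    [seq y ^+ e * d | e <- iota 0 p, d <- power_products Y']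
  else [:: 1].

Lemma mem_power_products y Y e d :
  y ^+ p = 1 -> d \in power_products Y -> y ^+ e * d \in power_products (y :: Y).
Proof.
move=> yp Dd; rewrite -(expg_modp e yp); apply: allpairs_f => //.
by rewrite mem_iota ltn_mod.
Qed.

Lemma commute_power_products x Y d : (forall y, y \in Y -> commute x y) ->
  d \in power_products Y -> commute x d.
Proof.
elim: Y d => [|y Y IHY] d cxY; first by rewrite inE => /eqP->; apply: commute1.
case/allpairsP=> -[e d'] [_ Dd' ->]; apply: commuteM.
  by apply/commuteX/cxY; rewrite inE eqxx.
by apply: IHY => // z Yz; apply: cxY; rewrite inE Yz orbT.
Qed.

Lemma gen_power_products Y z : {in Y &, forall x y, commute x y} ->
  (forall y, y \in Y -> y ^+ p = 1) -> gen [set` Y] z -> z \in power_products Y.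
Proof.
move=> cY Yp; move: z; apply: gen_subP.
  elim: Y cY Yp => [|y Y IHY] cY Yp.
    apply/subgroupP; split=> [|u v]; rewrite /= !inE // => /eqP -> /eqP ->.
    by rewrite mulgV.
  have yp : y ^+ p = 1 by apply: Yp; rewrite inE eqxx.
  have /subgroupP[D1 DV] : is_subgroup [set z | z \in power_products Y].
    by apply: IHY => [u v Yu Yv|u Yu]; [apply: cY | apply: Yp];
      rewrite inE ?Yu ?Yv orbT.
  have cyD d : d \in power_products Y -> commute y d.
    apply: commute_power_products => u Yu; apply: cY;
      by rewrite inE ?eqxx ?Yu ?orbT.
  apply/subgroupP; split=> [|u v].
    by rewrite /= -[1](mul1g 1) -{1}(expg0 y); apply: mem_power_products.
  case/allpairsP=> -[e d] [_ Dd ->] /allpairsP[[f d'] [_ Dd' ->]] /=.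
  have -> : y ^+ e * d / (y ^+ f * d') = y ^+ (e + p.-1 * f) * (d / d').
    have cyd : commute (d / d') (y ^- f).
      apply: commuteV; apply: commute_sym; apply: commute_sym; apply: commuteX.
      by apply: commute_sym; apply: commuteM; [|apply: commuteV]; apply: cyD.
    rewrite invgM expgnDr expg_predp // -!mulgA; congr (_ * _).
    by rewrite mulgA cyd.
  by apply: mem_power_products => //; apply: DV.
have D1 Z : 1 \in power_products Z.
  elim: Z => [|u Z IHZ] /=; first by rewrite inE.
  apply/allpairsP; exists (0, 1); split; rewrite ?mul1g //=.
  by rewrite mem_iota p_gt0.
elim: Y {cY} Yp => [//|y Y IHY] Yp z; rewrite /= inE => /orP[/eqP -> |Yz].
  rewrite -[y in X in X \in _]mulg1 -(expg1 y); apply: mem_power_products => //.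
  by apply: Yp; rewrite inE eqxx.
rewrite -[z]mul1g -(expg0 y); apply: mem_power_products.
  by apply: Yp; rewrite inE eqxx.
by apply: IHY => // u Yu; apply: Yp; rewrite inE Yu orbT.
Qed.

End FiniteExponent.
Section NilpotentFinite.
Variables (G : groupType) (p c : nat) (x y : G).
Implicit Types u v w a d g h z : G.
Hypothesis p_pr : prime p.
Hypothesis gen_xy : generates [set x; y].
Hypotheses (xp : x ^+ p = 1) (yp : y ^+ p = 1).

Lemma finite_index_fg (N : set G) (R : seq G) : is_subgroup N ->
    (forall z, exists2 a, a \in R & N (a^-1 * z)) ->
  exists2 Y : seq G, forall z, z \in Y -> N z & forall z, N z -> gen [set` Y] z.
Proof.
move=> sN Rtr.
have /choice[r rP] : forall z, exists a, a \in R /\ N (a^-1 * z).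
  by move=> z; have [a] := Rtr z; exists a.
have rR z : r z \in R by case: (rP z).
have rN z : N ((r z)^-1 * z) by case: (rP z).
(* Schreier generators for the transversal r. *)
pose sch g a := (r (g * a))^-1 * (g * a).
pose Y := [:: (r 1)^-1 * 1] ++ [seq sch g a | g <- [:: x; y], a <- R]
            ++ [seq a <- R | `[< N a >]].
have memY z : (z \in Y) = [|| z \in [:: (r 1)^-1 * 1],
    z \in [seq sch g a | g <- [:: x; y], a <- R] | z \in [seq a <- R | `[< N a >]]].
  by rewrite mem_cat mem_cat.
exists Y => [z|z Nz].
  rewrite memY => /or3P[|/allpairsPdep[g [a [_ _ ->]]]|].
  - by rewrite inE => /eqP ->.
  - exact: rN.
  - by rewrite mem_filter => /andP[/asboolP].
have sY := subgroup_gen [set` Y].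
suffices [a Ra [h Yh zE]] : exists2 a, a \in R &
    exists2 h, gen [set` Y] h & z = a * h.
  rewrite zE; apply: (subgroupM sY) => //; apply: (@sub_gen G [set` Y]).
  rewrite /= memY mem_filter Ra andbT; apply/orP; right; apply/orP; right.
  apply/asboolP; have -> : a = z * h^-1 by rewrite zE mulgK.
  apply: (subgroupM sN) => //; apply: (subgroupV sN).
  apply: gen_subP Yh => // u; rewrite /= memY.
  case/or3P=> [|/allpairsPdep[g [b [_ _ ->]]]|]; last first.
  - by rewrite mem_filter => /andP[/asboolP].
  - exact: rN.
  - by rewrite inE => /eqP ->.
have step g w : g \in [:: x; y] ->
  (exists2 a, a \in R & exists2 h, gen [set` Y] h & w = a * h) ->
  exists2 a, a \in R & exists2 h, gen [set` Y] h & g * w = a * h.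
  move=> gxy [a Ra [h Yh ->]]; exists (r (g * a)) => //.
  exists (sch g a * h); last by rewrite /sch !mulgA mulgV mul1g.
  apply: (subgroupM sY) => //; apply: (@sub_gen G [set` Y]); rewrite /= memY.
  by apply/orP; right; apply/orP; left; apply: allpairs_f.
move: z {Nz}; apply: (generates_ind_mul (prime_gt0 p_pr) gen_xy xp yp).
- exists (r 1) => //; exists ((r 1)^-1 * 1); last by rewrite mulVKg.
  by apply: (@sub_gen G [set` Y]); rewrite /= memY inE eqxx.
- by move=> z; apply: step; rewrite inE eqxx.
- by move=> z; apply: step; rewrite !inE eqxx orbT.
Qed.

Hypothesis lcs_triv : forall z, lcs c z -> z = 1.

(** A finite transversal of [lcs s] makes [lcs s] finitely generated. By [lcs_expp] its quotient by
    [lcs s.+1] is then abelian, finitely generated and of exponent dividing [p], hence finite, and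
    the transversal extends to [lcs s.+1]. *)
Lemma nilpotent_finite : finite_set [set: G].
Proof.
suffices [R RP]: exists R : seq G, forall z, exists2 a, a \in R & lcs c (a^-1 * z).
  apply: (sub_finite_set _ (finite_seq R)) => z _ /=.
  by have [a Ra /lcs_triv/mulg1_eq] := RP z; rewrite invgK => <-.
elim: c => [|s [R RP]]; first by exists [:: 1] => z; exists 1; rewrite ?inE.
have [Y YN NY] := finite_index_fg (@lcs_subgroup G s) RP.
pose K := NormalSubgroup (@lcs_normal G s.+1).
pose D := power_products p [seq coset K w | w <- Y].
exists [seq a * repr b | a <- R, b <- D] => z; have [a Ra Na] := RP z.
exists (a * repr (coset K (a^-1 * z))); last first.
  by rewrite invgM -mulgA; apply/(coset_eqP K); rewrite coset_repr.
apply: allpairs_f => //; apply: gen_power_products; first exact: prime_gt0.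
- move=> _ _ /mapP[u Yu ->] /mapP[v Yv ->]; apply/commgP/eqP.
  by rewrite -gmulfR; apply/coset_eq1; apply: lcsS_R; apply: (YN).
- move=> _ /mapP[u Yu ->]; rewrite -gmulfXn; apply/coset_eq1.
  apply: lcs_leq (lcs_expp p_pr gen_xy xp yp lcs_triv (YN _ Yu)).
  by have := prime_gt1 p_pr; lia.
have := @gen_morph _ _ (coset K) _ _ (NY _ Na); congr (gen _ _).
apply/seteqP; split=> [_ [u Yu <-]|_ /mapP[u Yu ->]] /=; last by exists u.
exact: map_f.
Qed.

Lemma lcs_exppX z m : lcs (m * p.-1) (z ^+ (p ^ m)).
Proof.
elim: m => [|m IHm]; first by [].
rewrite expnSr expgnA mulSn addnC.
exact: (lcs_expp p_pr gen_xy xp yp lcs_triv IHm).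
Qed.

Lemma expgpX_eq1 z m : c <= m * p.-1 -> z ^+ (p ^ m) = 1.
Proof. by move=> le_cm; apply/lcs_triv/lcs_leq/lcs_exppX. Qed.

End NilpotentFinite.

(** * The p-central quotients of the free product *)

Section PcentralQuotient.
Variables (p n : nat).
Hypotheses (p_pr : prime p) (n_gt0 : 0 < n).
Local Notation F := (free_product_cyclic p).
Local Notation G := (quotient_group (pcentral F p n)).

Definition of_word (w : word bool) : F :=
  \pi_(presented_group [set nseq p (b, false) | b in [set: bool]]) w.

Lemma of_word_cat u v : of_word (u ++ v) = of_word u * of_word v.
Proof. by rewrite -[RHS]/(presented_mul _ _) presented_mulE. Qed.

Lemma of_word_inv u : of_word (inv_word u) = (of_word u)^-1.
Proof. by rewrite -[RHS]/(presented_inv _) presented_invE. Qed.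

Lemma of_word_repr (g : F) : of_word (repr g) = g.
Proof. exact: reprK. Qed.

Definition letter (b : bool) : F := of_word [:: (b, false)].

Lemma letterX b k : letter b ^+ k = of_word (nseq k (b, false)).
Proof.
elim: k => [|k IHk]; first by [].
by rewrite expgS IHk -of_word_cat.
Qed.

Lemma letterXp b : letter b ^+ p = 1.
Proof. by rewrite letterX; apply/eq_presented/WordRelator; exists b. Qed.

Lemma letter_generates : generates [set letter true; letter false].
Proof.
apply/seteqP; split=> // g _; rewrite -[g]of_word_repr.
have sF := subgroup_gen [set letter true; letter false].
elim: (repr g) => [|[b e] w IHw]; first exact: (subgroup1 sF).
rewrite -cat1s of_word_cat.
apply: (subgroupM sF) => //.
have gb : gen [set letter true; letter false] (letter b).
  by apply: (@sub_gen _ [set letter true; letter false]); case: b; [left | right].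
case: e => //; rewrite -[[:: _]]/(inv_word [:: (b, false)]) of_word_inv.
exact: (subgroupV sF).
Qed.

Local Notation X := (coset (pcentral F p n) (letter true)).
Local Notation Y := (coset (pcentral F p n) (letter false)).

Lemma pq_generates : generates [set X; Y].
Proof.
apply/seteqP; split=> // a _; rewrite -[a]coset_repr.
have : gen [set letter true; letter false] (repr a) by rewrite letter_generates.
move/(@gen_morph _ _ (coset (pcentral F p n))).
apply: gen_subP; first exact: subgroup_gen.
by move=> _ [_ [->|->] <-]; apply: sub_gen; [left | right].
Qed.

Lemma pq_expX : X ^+ p = 1.
Proof. by rewrite -gmulfXn letterXp gmulf1. Qed.

Lemma pq_expY : Y ^+ p = 1.
Proof. by rewrite -gmulfXn letterXp gmulf1. Qed.

(** Each [lcs s] of the quotient lies in the image of [pcentral_set p s.+1]; the two series start at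
    0 and 1. *)
Lemma pq_lcs (a : G) : lcs n.-1 a -> a = 1.
Proof.
suffices LS s (b : G) : lcs s b ->
    exists2 g : F, pcentral_set p s.+1 g & coset (pcentral F p n) g = b.
  move=> /LS[g Lg <-]; apply/coset_eq1; rewrite /= -(prednK n_gt0); exact: Lg.
elim: s b => [|s IHs] b.
  by exists (repr b) => //; apply: coset_repr.
have sK := (@normal_pcentral_set F p s.+2).1.
move: b; apply: (@lcsS_ind _ _ [set b | exists2 g : F,
  pcentral_set p s.+2 g & coset (pcentral F p n) g = b]) => [|u g /IHs[h Lh <-]].
  apply/subgroupP; split=> [|u v [g Lg <-] [h Lh <-]].
    by exists 1; [apply: subgroup1 | rewrite gmulf1].
  by exists (g / h); [case/subgroupP: sK => _; apply | rewrite gmulfF].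
exists [~ h, repr g]; last by rewrite gmulfR /= coset_repr.
rewrite /pcentral_set /=.
exists [~ h, repr g]; first by apply: sub_gen; exists h => //; exists (repr g).
by exists 1; rewrite ?mulg1 //; apply: subgroup1; apply: subgroup_gen.
Qed.

End PcentralQuotient.

(** * Affine representations of the free product *)

Section AffineRepresentations.
Import GRing.Theory.
Local Open Scope ring_scope.
Variables (R : nzRingType) (p : nat).
Local Notation F := (free_product_cyclic p).

(* g |-> (z |-> u g * z + a g) is a homomorphism to the affine group of R. *)
Definition affine_rep (u a : F -> R) : Prop :=
  [/\ u 1%g = 1, forall g h, u (g * h)%g = u g * u h &
      forall g h, a (g * h)%g = a g + u g * a h].

Section Existence.
Variables lu la : bool -> R.
Hypotheses (p_gt0 : (0 < p)%N) (lu_p : forall b, lu b ^+ p = 1).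
Hypothesis la_p : forall b, (\sum_(i < p) lu b ^+ i) * la b = 0.

Definition affine_mul (q r : R * R) : R * R := (q.1 * r.1, q.2 + q.1 * r.2).

(** Under [lu b ^+ p = 1], the first branch is the inverse of the affine map of the second. *)
Definition affine_letter (l : bool * bool) : R * R :=
  if l.2 then (lu l.1 ^+ p.-1, - (lu l.1 ^+ p.-1 * la l.1))
  else (lu l.1, la l.1).

Definition affine_word (w : word bool) : R * R :=
  foldr (fun l => affine_mul (affine_letter l)) (1, 0) w.

Lemma affine_mulA : associative affine_mul.
Proof. by move=> q r s; rewrite /affine_mul /= mulrDr !mulrA !addrA. Qed.

Lemma affine_mul1 q : affine_mul (1, 0) q = q.
Proof. by case: q => u a; rewrite /affine_mul /= !mul1r add0r. Qed.

Lemma affine_word_cat v w :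
  affine_word (v ++ w) = affine_mul (affine_word v) (affine_word w).
Proof.
elim: v => [|l v IHv]; first by rewrite affine_mul1.
by rewrite /= IHv affine_mulA.
Qed.

Lemma affine_word_nseq b k :
  affine_word (nseq k (b, false)) = (lu b ^+ k, (\sum_(i < k) lu b ^+ i) * la b).
Proof.
elim: k => [|k IHk]; first by rewrite big_ord0 mul0r.
rewrite /= IHk /affine_mul /= -exprS big_ord_recl mulrDl mul1r mulrA.
by rewrite mulr_sumr; congr (_, _ + _ * _); apply: eq_bigr => i _; rewrite -exprS.
Qed.

Lemma affine_word_eq v w :
  word_eq [set nseq p (b, false) | b in [set: bool]] v w ->
  affine_word v = affine_word w.
Proof.
elim=> {v w} [//|u v _ -> //|u v w _ -> _ -> //|u u' v v' _ Eu _ Ev|b e|_ [b _ <-]].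
- by rewrite !affine_word_cat Eu Ev.
- have lK : lu b ^+ p.-1 * lu b = 1 by rewrite -exprSr prednK.
  have Kl : lu b * lu b ^+ p.-1 = 1 by rewrite -exprS prednK.
  case: e; rewrite /= /affine_mul /affine_letter /= !mulr1 !mulr0 !addr0.
    by rewrite lK addNr.
  by rewrite Kl mulrN mulrA Kl mul1r subrr.
- by rewrite affine_word_nseq lu_p la_p.
Qed.

Lemma affine_rep_exists : exists u a : F -> R,
  [/\ affine_rep u a, forall b, u (letter p b) = lu b
    & forall b, a (letter p b) = la b].
Proof.
pose ev (g : F) := affine_word (repr g).
have evE w : ev (of_word p w) = affine_word w.
  by apply: affine_word_eq; apply: repr_presented.
have evM g h : ev (g * h)%g = affine_mul (ev g) (ev h).
  rewrite -{1}[g]of_word_repr -{1}[h]of_word_repr -of_word_cat.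
  by rewrite evE affine_word_cat.
exists (fun g => (ev g).1), (fun g => (ev g).2); split=> [|b|b].
- by split=> [|g h|g h]; rewrite ?evM //; have := evE [::]; rewrite /of_word => ->.
- by rewrite evE /= mulr1.
- by rewrite evE /= mulr0 addr0.
Qed.

End Existence.

Section Congruence.
Variables (u a : F -> R) (zeta r0 : R).
Hypotheses (p_gt0 : (0 < p)%N) (ua : affine_rep u a) (zeta_p : zeta ^+ p = 1).
Hypothesis u_letter : forall b, exists k, u (letter p b) = zeta ^+ k.
Hypothesis p_pi : p%:R = (1 - zeta) * r0.
Local Notation pi := (1 - zeta).

Lemma rep_u1 : u 1%g = 1. Proof. by case: ua. Qed.

Lemma rep_uM g h : u (g * h)%g = u g * u h. Proof. by case: ua. Qed.

Lemma rep_aM g h : a (g * h)%g = a g + u g * a h. Proof. by case: ua. Qed.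

Lemma rep_a1 : a 1%g = 0.
Proof.
have := rep_aM 1 1; rewrite mulg1 rep_u1 mul1r.
by rewrite -[X in X = _]addr0 => /addrI.
Qed.

Lemma rep_uX g k : u (g ^+ k)%g = u g ^+ k.
Proof. by elim: k => [|k IHk]; rewrite ?rep_u1 // expgS rep_uM IHk exprS. Qed.

Lemma rep_aX g k : a (g ^+ k)%g = (\sum_(i < k) u g ^+ i) * a g.
Proof.
elim: k => [|k IHk]; first by rewrite rep_a1 big_ord0 mul0r.
rewrite expgS rep_aM IHk big_ord_recl mulrDl mul1r mulrA mulr_sumr.
by congr (_ + _ * _); apply: eq_bigr => i _; rewrite -exprS.
Qed.

Lemma rep_aX1 g k : u g = 1 -> a (g ^+ k)%g = a g *+ k.
Proof.
move=> ug; rewrite rep_aX ug; under eq_bigr do rewrite expr1n.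
by rewrite sumr_const card_ord mulr_natl.
Qed.

Lemma zeta_inv k : zeta ^+ (p.-1 * k) * zeta ^+ k = 1.
Proof. by rewrite -exprD addnC -mulSn prednK // exprM zeta_p expr1n. Qed.

Lemma rep_u g : exists k, u g = zeta ^+ k.
Proof.
move: g; apply: (generates_ind (letter_generates p)).
  apply/subgroupP; split=> [|g h [k Ek] [l El]].
    by exists 0%N; rewrite rep_u1.
  exists (k + p.-1 * l)%N; rewrite rep_uM Ek exprD; congr (_ * _).
  have := rep_uM h h^-1; rewrite mulgV rep_u1 El => E.
  by rewrite -[LHS]mul1r -(zeta_inv l) -mulrA -E mulr1.
by move=> _ [] ->; apply: u_letter.
Qed.

Lemma zetaB k : 1 - zeta ^+ k = pi * \sum_(i < k) zeta ^+ i.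
Proof. by rewrite -[LHS]opprB subrX1 -mulNr opprB. Qed.

Lemma pi_comm k l : pi ^+ k * zeta ^+ l = zeta ^+ l * pi ^+ k.
Proof.
have /(commrX k) : GRing.comm (zeta ^+ l) pi.
  exact: commrB (commr1 _) (commr_sym (commrX l (commr_refl zeta))).
by [].
Qed.

(** The sum is [p] minus terms [1 - zeta ^+ (k * i)], and [pi] divides all of these. *)
Lemma sum_zeta k : exists r, \sum_(i < p) (zeta ^+ k) ^+ i = pi * r.
Proof.
exists (r0 - \sum_(i < p) \sum_(j < k * i) zeta ^+ j).
rewrite mulrBr -p_pi mulr_sumr; under [X in _ - X]eq_bigr do rewrite -zetaB.
rewrite sumrB sumr_const card_ord subKr.
by apply: eq_bigr => i _; rewrite exprM.
Qed.

Definition pi_translations s : set F :=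
  [set g | u g = 1 /\ exists r, a g = pi ^+ s * r].

Lemma pi_translations_subgroup s : is_subgroup (pi_translations s).
Proof.
apply/subgroupP; split=> [|g h [ug [r ag]] [uh [t ah]]].
  by split; [exact: rep_u1 | exists 0; rewrite rep_a1 mulr0].
have uV : u h^-1 = 1 by have := rep_uM h h^-1; rewrite mulgV rep_u1 uh mul1r.
have aV : a h^-1 = - a h.
  have := rep_aM h h^-1; rewrite mulgV rep_a1 uh mul1r => /esym/eqP.
  by rewrite addrC addr_eq0 => /eqP.
split; first by rewrite rep_uM ug uV mul1r.
by exists (r - t); rewrite rep_aM ug mul1r aV ag ah mulrBr.
Qed.

Lemma rep_comm g h : exists k, u [~ g, h] = 1 /\
  a [~ g, h] = zeta ^+ k * ((1 - u h) * a g - (1 - u g) * a h).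
Proof.
have [[k ug] [l uh]] := (rep_u g, rep_u h).
have [cu] := rep_u [~ g, h].
have E : u g * u h = u h * u g * u [~ g, h].
  by rewrite -!rep_uM -commgC.
have Ea : a g + u g * a h = a h + u h * a g + u h * u g * a [~ g, h].
  by rewrite -rep_aM commgC rep_aM rep_aM rep_uM.
(* The exponent of the inverse of [u h * u g]; the formula results from comparing [g * h] with [h *
   g * [~ g, h]]. *)
exists (p.-1 * (k + l))%N; move: E Ea.
have -> : u h * u g = zeta ^+ (k + l) by rewrite ug uh -exprD addnC.
have -> : u g * u h = zeta ^+ (k + l) by rewrite ug uh -exprD.
move=> E Ea; split.
  by rewrite -[LHS]mul1r -(zeta_inv (k + l)) -mulrA -E zeta_inv.
rewrite -[LHS]mul1r -[1 in LHS](zeta_inv (k + l)) -mulrA; congr (_ * _).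
rewrite !mulrBl !mul1r; apply/(addrI (a h + u h * a g)); rewrite -Ea.
rewrite opprB [a h + _ in RHS]addrC addrACA [u h * _ + _]addrC subrK.
by rewrite [a h + _]addrC subrK.
Qed.

(** The first step down the series makes linear parts trivial and translations divisible by [pi].
    Each later step gains one factor [pi]: commutators from [1 - u h], [p]-th powers from [p]
    itself. *)
Lemma pcentral_translations s : pcentral_set p s.+2 `<=` pi_translations s.+1.
Proof.
suffices step (H : set F) s' :
    (forall g h, H g -> pi_translations s' [~ g, h]) ->
    (forall g, H g -> pi_translations s' (g ^+ p)%g) ->
  mul_set (comm_subgroup H setT) (pow_subgroup p H) `<=` pi_translations s'.
  have pi_multiple k l r : exists t, zeta ^+ k * (pi ^+ l * r) = pi ^+ l * t.
    by exists (zeta ^+ k * r); rewrite !mulrA pi_comm.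
  elim: s => [|s IHs]; apply: step => g.
  - move=> h _; have [k [uc ac]] := rep_comm g h; split=> //; rewrite ac.
    have [[i ->] [j ->]] := (rep_u g, rep_u h).
    by rewrite !zetaB -!mulrA -mulrBr -[X in X * (_ - _)]expr1; apply: pi_multiple.
  - move=> _; have [k ug] := rep_u g; split.
      by rewrite rep_uX ug -exprM mulnC exprM zeta_p expr1n.
    have [r E] := sum_zeta k; exists (r * a g).
    by rewrite rep_aX ug E mulrA.
  - move=> h /IHs[ug [r ag]]; have [k [uc ac]] := rep_comm g h; split=> //.
    have [l uh] := rep_u h; rewrite ac ug subrr mul0r subr0 ag uh zetaB.
    rewrite -mulrA [_ * (pi ^+ _ * r)]mulrA.
    have -> : (\sum_(i < l) zeta ^+ i) * pi ^+ s.+1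
        = pi ^+ s.+1 * (\sum_(i < l) zeta ^+ i).
      by rewrite mulr_suml mulr_sumr; apply: eq_bigr => i _; rewrite pi_comm.
    by rewrite -mulrA mulrA -exprS; apply: pi_multiple.
  - move=> /IHs[ug [r ag]]; split; first by rewrite rep_uX ug expr1n.
    exists (r0 * r); rewrite rep_aX1 // ag -mulr_natr -mulrA mulr_natr -mulr_natl.
    by rewrite p_pi !mulrA -exprSr.
move=> Hc Hp _ [v gv [w gw <-]]; have sT := pi_translations_subgroup s'.
apply: (subgroupM sT).
  by apply: (gen_subP sT) gv => _ [g Hg [h _ <-]]; apply: Hc.
by apply: (gen_subP sT) gw => _ [g Hg <-]; apply: Hp.
Qed.

Lemma coset_rep n g h : (1 < n)%N ->
  coset (pcentral F p n) g = coset (pcentral F p n) h ->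
  u g = u h /\ exists r, a h = a g + pi ^+ n.-1 * r.
Proof.
case: n => [|[|n]] // _ /coset_eqP/pcentral_translations[ul [r al]].
have [k ug] := rep_u g; split.
  by rewrite -[h in RHS](mulVKg g) rep_uM ul mulr1.
exists (u g * r); rewrite -{1}(mulVKg g h) rep_aM al ug.
by rewrite !mulrA pi_comm.
Qed.

Lemma rep_aJ g k : u g = 1 -> u k * a (g ^ k) = a g.
Proof.
move=> ug; have := rep_aM k (g ^ k); rewrite -conjgC rep_aM ug mul1r.
by rewrite addrC => /addrI.
Qed.

Lemma rep_uJ g k : u (g ^ k) = u g.
Proof.
have [[i uk] [j ug]] := (rep_u k, rep_u g).
have := congr1 u (conjgC g k); rewrite !rep_uM ug uk => E.
rewrite -[LHS]mul1r -(zeta_inv i) -mulrA -E mulrA -exprD addnC exprD -mulrA.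
by rewrite zeta_inv mulr1.
Qed.

End Congruence.
End AffineRepresentations.

(** * Integer matrices for the p-th cyclotomic ring *)

Section Cyclotomic.
Import Order.TTheory GRing.Theory Num.Theory.
Local Open Scope ring_scope.

Lemma size_sum_Xn p : size (\sum_(i < p.+1) 'X^i : {poly int}) = p.+1.
Proof.
elim: p => [|p IHp]; first by rewrite big_ord1 expr0 size_poly1.
by rewrite big_ord_recr /= addrC size_polyDl size_polyXn // IHp.
Qed.

Lemma lead_coef_sum_Xn p : \sum_(i < p.+1) 'X^i \is @monic int.
Proof.
apply/monicP; case: p => [|p]; first by rewrite big_ord1 lead_coef1.
by rewrite big_ord_recr /= lead_coefDr ?lead_coefXn // size_polyXn size_sum_Xn.
Qed.

(* The determinant of 1 - zeta plays the role of the norm of the element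
   1 - zeta of the ring of integers of the p-th cyclotomic field. *)
Lemma cyclotomic_matrix p : prime p -> exists m, exists zeta : 'M[int]_m.+1,
  [/\ p = m.+2, \sum_(i < p) zeta ^+ i = 0 & \det (1 - zeta) = p%:R].
Proof.
case: p => [|[|p]] // _; exists p.
pose Phi : {poly int} := \sum_(i < p.+2) 'X^i.
have [Z EZ] : exists Z : 'M[int]_p.+1, char_poly Z = Phi.
  have Es : (size Phi).-1 = p.+1 by rewrite size_sum_Xn.
  move: (companionmx Phi) (companionmxK (lead_coef_sum_Xn p.+1)).
  by rewrite -/Phi Es => Z EZ; exists Z.
exists Z; split=> //.
  have := Cayley_Hamilton Z; rewrite EZ rmorph_sum /= => E; rewrite -[RHS]E.
  by apply: eq_bigr => i _; rewrite rmorphXn /= horner_mx_X.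
(* The characteristic polynomial at 1 is the determinant of [1 - Z], and all [p.+2] terms of [Phi]
   take the value 1 there. *)
have : (char_poly Z).[1] = p.+2%:R.
  rewrite EZ horner_sum; under eq_bigr do rewrite hornerXn expr1n.
  by rewrite sumr_const card_ord.
move=> <-; rewrite -[RHS]/(horner_eval 1 _) -det_map_mx; congr (\det _).
apply/matrixP => i j; rewrite !mxE /= /horner_eval hornerD hornerN hornerC.
by rewrite hornerMn hornerX.
Qed.

End Cyclotomic.

(** * The cyclic shift of order 3 over F_3 *)

Section CyclicShift.
Import Order.TTheory GRing.Theory.
Local Open Scope ring_scope.

Lemma F3_mulrn3 (V : lmodType 'F_3) (v : V) : v *+ 3 = 0.
Proof. by rewrite -scaler_nat pchar_Fp_0 ?scale0r. Qed.

Definition shift3 : {perm 'I_3} := perm (@ordS_inj 3).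

Definition shift3_mx : 'M['F_3]_3 := perm_mx shift3.

Lemma shift3_mxX k : shift3_mx ^+ k = perm_mx (shift3 ^+ k)%g.
Proof.
elim: k => [|k IHk]; first by rewrite expr0 perm_mx1.
by rewrite exprS IHk expgS perm_mxM.
Qed.

Lemma shift3X k : (shift3 ^+ k)%g 0 = (k %% 3)%N :> nat.
Proof.
elim: k => [|k IHk]; first by rewrite perm1.
by rewrite expgSr permM permE /= IHk -addn1 modnDml addn1.
Qed.

Lemma shift3_mx_row k (c : 'I_3) : (shift3_mx ^+ k) 0 c = ((k %% 3)%N == c)%:R.
Proof. by rewrite shift3_mxX !mxE -val_eqE /= shift3X. Qed.

Lemma shift3_mx3 : shift3_mx ^+ 3 = 1.
Proof.
rewrite shift3_mxX -[RHS]perm_mx1; congr perm_mx; apply/permP => i.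
rewrite perm1 !expgS expg0 mulg1 !permM !permE.
by apply/val_inj; case: i => [[|[|[|]]]].
Qed.

(** In characteristic 3, [(1 - S) ^+ 2 = 1 + S + S ^+ 2], so the cube is [1 - S ^+ 3]. *)
Lemma shift3_mx_nilp : (1 - shift3_mx) ^+ 3 = 0.
Proof.
have -> : (1 - shift3_mx) ^+ 3 = (1 - shift3_mx) * \sum_(i < 3) shift3_mx ^+ i.
  rewrite exprS; congr (_ * _); rewrite !big_ord_recl big_ord0 expr0 expr1 !expr2.
  rewrite mulrBl !mulrBr !mul1r mulr1; apply/eqP; rewrite -subr_eq0 addr0.
  rewrite -oppr_eq0 -(F3_mulrn3 shift3_mx); apply/eqP/matrixP => i j.
  by rewrite mulmxnE !mxE; ring.
by rewrite -[LHS]zetaB shift3_mx3 subrr.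
Qed.

(* One of the entries 1 and 2 of the first row of shift3_mx ^+ k vanishes. *)
Lemma shift3_mx_multiple k i j (M : 'M['F_3]_3) :
    M 0 1 = 1 -> M 0 2 = 1 -> shift3_mx ^+ k *+ i = M *+ j ->
  (3 %| i)%N.
Proof.
move=> M1 M2 E.
have Ec (c : 'I_3) : ((k %% 3)%N == c)%:R *+ i = (M 0 c) *+ j.
  by rewrite -shift3_mx_row -!mulmxnE E.
have j0 : j%:R = 0 :> 'F_3.
  have [k1|k1] := eqVneq (k %% 3)%N 1%N.
    by have := Ec 2; rewrite k1 M2 /= mul0rn.
  by have := Ec 1; rewrite (negPf k1) M1 /= mul0rn.
have lt_k3 : (k %% 3 < 3)%N by rewrite ltn_mod.
have := Ec (Ordinal lt_k3); rewrite eqxx /= -[M 0 _ *+ j]mulr_natr j0 mulr0.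
by move/eqP; rewrite (dvdn_pcharf (pchar_Fp (isT : prime 3))).
Qed.

End CyclicShift.

(** * Disjointness of conjugates of cyclic subgroups *)

Section Independence.
Variable G : groupType.
Implicit Types w v x y z : G.

Definition indep w v : Prop := forall i j g h,
  (w ^+ i) ^ g = (v ^+ j) ^ h -> w ^+ i = 1.

Lemma gen1P q w z : (0 < q)%N -> w ^+ q = 1 ->
  gen [set w] z -> exists i, z = w ^+ i.
Proof.
move=> q_gt0 wq; move: z; apply: gen_subP => [|_ ->]; last by exists 1%N.
apply/subgroupP; split=> [|_ _ [i ->] [j ->]]; first by exists 0%N.
by exists (i + q.-1 * j)%N; rewrite expgnDr expg_predp.
Qed.

Lemma SigmaP q x y z : (0 < q)%N -> (forall w : G, w ^+ q = 1) -> Sigma x y z ->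
  exists2 w, w \in [:: x; y; x * y] & exists i g, z = (w ^+ i) ^ g.
Proof.
move=> q0 wq [g _ [[]|]] [t /(gen1P q0 (wq _))[i ->] <-].
- by exists x; rewrite ?inE ?eqxx //; exists i, g.
- by exists y; rewrite ?inE ?eqxx ?orbT //; exists i, g.
- by exists (x * y); rewrite ?inE ?eqxx ?orbT //; exists i, g.
Qed.

Lemma mem_Sigma x y w i g :
  w \in [:: x; y; x * y] -> Sigma x y ((w ^+ i) ^ g).
Proof.
have gX v : gen [set v] (v ^+ i).
  exact: (@subgroupX _ _ v i (subgroup_gen [set v]) (@sub_gen _ [set v] v erefl)).
rewrite !inE => /or3P[] /eqP ->; exists g => //; [left; left|left; right|right].
- by exists (x ^+ i).
- by exists (y ^+ i).
- by exists ((x * y) ^+ i).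
Qed.

Lemma Sigma_disjoint q x1 y1 x2 y2 : (0 < q)%N -> (forall w : G, w ^+ q = 1) ->
    {in [:: x1; y1; x1 * y1] & [:: x2; y2; x2 * y2], forall w v, indep w v} ->
  Sigma x1 y1 `&` Sigma x2 y2 = [set 1].
Proof.
move=> q0 wq ind; apply/seteqP; split=> [z [S1 S2]|_ ->].
  have [w w1 [i [g zE]]] := SigmaP q0 wq S1.
  have [v v2 [j [h zE']]] := SigmaP q0 wq S2.
  rewrite zE' in zE *; have := ind _ _ w1 v2 i j g h (esym zE).
  by move=> E; rewrite zE E conj1g.
split; rewrite /= -(conj1g 1); [rewrite -{1}(expg0 x1)|rewrite -{1}(expg0 x2)];
  by apply: mem_Sigma; rewrite inE eqxx.
Qed.

End Independence.

Section Directions.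
Import Order.TTheory GRing.Theory Num.Theory.
Variables (p n : nat).
Hypotheses (p_pr : prime p) (n_gt1 : (1 < n)%N).
Local Notation F := (free_product_cyclic p).
Local Notation N := (pcentral F p n).
Local Notation G := (quotient_group N).
Local Notation X := (coset N (letter p true)).
Local Notation Y := (coset N (letter p false)).

Lemma Fp_p : (p%:R = 0 :> 'F_p)%R.
Proof. by apply/pcharf0/pchar_Fp. Qed.

Lemma Fp_natr_eq0 i : (i%:R == 0 :> 'F_p)%R = (p %| i).
Proof. by rewrite (dvdn_pcharf (pchar_Fp p_pr)). Qed.

(** Taken from an affine representation with trivial linear part, whose translation part is
    additive. With [zeta = 1] the congruence modulo [pi ^+ n.-1] is an equality because [n > 1]. *)
Lemma direction_exists (al be : 'F_p) : exists d : G -> 'F_p,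
  [/\ forall a b, d (a * b) = (d a + d b)%R, d X = al & d Y = be].
Proof.
have p0 := prime_gt0 p_pr.
have [||u [a [ua ul al_]]] := @affine_rep_exists 'F_p p (fun=> 1%R)
  (fun b => if b then al else be) p0.
- by move=> b; rewrite expr1n.
- move=> b; under eq_bigr do rewrite expr1n.
  by rewrite sumr_const card_ord Fp_p mul0r.
have rel g h : coset N g = coset N h -> a g = a h.
  move=> gh.
  have [|||_ [r ->]] := @coset_rep _ p u a 1%R 0%R p0 ua _ _ _ n g h n_gt1 gh.
  - by rewrite expr1n.
  - by move=> b; exists 0%N; rewrite ul.
  - by rewrite subrr mul0r Fp_p.
  by rewrite subrr expr0n -subn1 subn_eq0 leqNgt n_gt1 mul0r addr0.
have u1 g : u g = 1%R.
  have [||k ->] := @rep_u _ p u a 1%R p0 ua _ _ g; rewrite ?expr1n //.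
  by move=> b; exists 0%N; rewrite ul.
exists (fun c => a (repr c)); split=> [b c||].
- rewrite (rel _ (repr b * repr c)); first by case: ua => _ _ ->; rewrite u1 mul1r.
  by rewrite gmulfM /= !coset_repr.
- by rewrite (rel _ (letter p true)) ?coset_repr ?al_.
- by rewrite (rel _ (letter p false)) ?coset_repr ?al_.
Qed.

Section Additive.
Variable d : G -> 'F_p.
Hypothesis dM : forall a b, d (a * b) = (d a + d b)%R.

Lemma dir1 : d 1 = 0%R.
Proof. by apply/(addrI (d 1)); rewrite -dM mulg1 addr0. Qed.

Lemma dirV a : d a^-1 = (- d a)%R.
Proof. by apply/(addrI (d a)); rewrite -dM mulgV dir1 subrr. Qed.

Lemma dirX a k : d (a ^+ k) = (d a *+ k)%R.
Proof. by elim: k => [|k IHk]; rewrite ?dir1 // expgS dM IHk mulrS. Qed.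

Lemma dirJ a b : d (a ^ b) = d a.
Proof. by rewrite /conjg !dM dirV addrC addrK. Qed.

End Additive.

Variables dx dy : G -> 'F_p.
Hypothesis dxM : forall a b, dx (a * b) = (dx a + dx b)%R.
Hypothesis dyM : forall a b, dy (a * b) = (dy a + dy b)%R.
Hypotheses (dxX : dx X = 1%R) (dxY : dx Y = 0%R).
Hypotheses (dyX : dy X = 0%R) (dyY : dy Y = 1%R).

Lemma generates_dir (A : set G) (al be : 'F_p) : generates A ->
  (forall a, A a -> al * dx a + be * dy a = 0)%R -> al = 0%R /\ be = 0%R.
Proof.
move=> gA A0.
have ab a : (al * dx a + be * dy a = 0)%R.
  apply: (generates_ind gA _ A0 a); apply/subgroupP; split=> [|b c Eb Ec] /=.
    by rewrite (dir1 dxM) (dir1 dyM) !mulr0 addr0.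
  rewrite dxM dyM (dirV dxM) (dirV dyM) !mulrDr !mulrN addrACA -opprD.
  by rewrite Eb Ec subrr.
have := ab X; have := ab Y; rewrite dxX dxY dyX dyY !mulr0 !mulr1.
by rewrite add0r addr0.
Qed.

Lemma generates_det a b : generates [set a; b] -> (dx a * dy b != dx b * dy a)%R.
Proof.
move=> gab; apply/negP => /eqP E.
(* With zero determinant, the linear form that annihilates the direction of [a] also annihilates
   that of [b], so the form is zero and [a] has direction zero; likewise [b]. *)
have [|a2 a1] := @generates_dir _ (dy a) (- dx a)%R gab.
  by move=> _ [] ->; rewrite mulNr ?E mulrC subrr.
have [|b2 b1] := @generates_dir _ (dy b) (- dx b)%R gab.
  by move=> _ [] ->; rewrite mulNr mulrC ?E subrr.
have [|] := @generates_dir _ 1%R 1%R gab; last by move/eqP; rewrite oner_eq0.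
move/eqP: a1; move/eqP: b1; rewrite !oppr_eq0 => /eqP b1 /eqP a1.
by move=> _ [] ->; rewrite ?a1 ?a2 ?b1 ?b2 !mulr0 addr0.
Qed.

Lemma pq_min_generators : min_generators G 2.
Proof.
split=> [|s gs].
  exists [:: X; Y]; split=> //.
  have := pq_generates p n; rewrite /generates => <-; congr gen.
  apply/seteqP; split=> z /=; rewrite !inE.
    by case/orP=> /eqP ->; [left | right].
  by case=> ->; rewrite eqxx ?orbT.
case: s gs => [|a [|b s]] // gs.
  have [|] := @generates_dir _ 1%R 1%R gs; first by [].
  by move/eqP; rewrite oner_eq0.
have sa z : [set` [:: a]] z -> z = a by rewrite /= inE => /eqP.
have [|a2 a1] := @generates_dir _ (dy a) (- dx a)%R gs.
  by move=> z /sa ->; rewrite mulNr mulrC subrr.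
have [|] := @generates_dir _ 1%R 1%R gs; last by move/eqP; rewrite oner_eq0.
move/eqP: a1; rewrite oppr_eq0 => /eqP a1.
by move=> z /sa ->; rewrite a1 a2 !mulr0 addr0.
Qed.

(** Conjugation preserves directions, so [i] times the nonzero determinant vanishes in ['F_p] and
    [p] divides [i]. *)
Lemma indep_dir w v : w ^+ p = 1 -> (dx w * dy v != dx v * dy w)%R -> indep w v.
Proof.
move=> wp; rewrite -subr_eq0 => D i j g h E.
have Ex := congr1 dx E; have Ey := congr1 dy E; move: Ex Ey.
rewrite !(dirJ dxM) !(dirJ dyM) !(dirX dxM) !(dirX dyM) => Ex Ey.
suffices /eqP : ((dx w * dy v - dx v * dy w) * i%:R = 0)%R.
  by rewrite mulf_eq0 (negPf D) Fp_natr_eq0 => /dvdnP[k ->];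
    rewrite mulnC expgnA wp expg1n.
rewrite mulr_natr mulrnBl -mulrnAl -mulrnAr Ex Ey.
by rewrite mulrnAl mulrnAr subrr.
Qed.

Section CyclotomicIndependence.
Variables (m : nat) (zeta : 'M[int]_m.+1).
Hypothesis p_m : p = m.+2.
Hypothesis zeta_sum : (\sum_(i < p) zeta ^+ i = 0)%R.
Hypothesis zeta_det : (\det (1 - zeta) = p%:R)%R.
Local Notation pi := (1 - zeta)%R.

Let p_gt0 : (0 < p)%N. Proof. exact: prime_gt0. Qed.

Lemma cyclotomic_p : (zeta ^+ p = 1)%R.
Proof. by apply/eqP; rewrite -subr_eq0 subrX1 zeta_sum mulr0. Qed.

Lemma cyclotomic_pi : exists r0, (p%:R = pi * r0)%R.
Proof.
exists (\sum_(i < p) \sum_(j < i) zeta ^+ j)%R; rewrite mulr_sumr.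
under eq_bigr do rewrite -zetaB.
by rewrite sumrB zeta_sum subr0 sumr_const card_ord.
Qed.

Lemma pi_neq0 : pi <> 0%R.
Proof.
move=> pi0; have /eqP := zeta_det; rewrite pi0 det0 eq_sym.
by rewrite pnatr_eq0 eqn0Ngt p_gt0.
Qed.

Lemma cyclotomic_dvd k : (zeta ^+ k = 1)%R -> p %| k.
Proof.
move=> zk; apply/negPn/negP; rewrite -prime_coprime // coprime_sym => co_kp.
have k_gt0 : (0 < k)%N by case: k {zk} co_kp => //; rewrite /coprime gcd0n p_m.
case: (egcdnP p k_gt0) => km kn E _; rewrite (eqP co_kp) in E.
apply: pi_neq0; apply/eqP; rewrite subr_eq0 eq_sym; apply/eqP.
rewrite -[zeta]expr1; have := congr1 (fun t => zeta ^+ t)%R E.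
by rewrite exprD mulnC exprM zk mulnC exprM cyclotomic_p !expr1n mul1r.
Qed.

(** The sum is killed by [1 - zeta ^+ e], hence by its multiple [pi] (as [e] is invertible modulo
    [p]), hence by [p]; integer matrices have no torsion. *)
Lemma cyclotomic_sum e : ~~ (p %| e) -> (\sum_(i < p) (zeta ^+ e) ^+ i = 0)%R.
Proof.
rewrite -prime_coprime // coprime_sym => co_ep.
have e_gt0 : (0 < e)%N by case: e co_ep => //; rewrite /coprime gcd0n p_m.
case: (egcdnP p e_gt0) => f g E _; rewrite (eqP co_ep) in E.
set S := (\sum_(i < p) _)%R.
have S0 : (S * (1 - zeta ^+ e) = 0)%R.
  have <- : (1 - (zeta ^+ e) ^+ p = 0)%R.
    by rewrite -exprM mulnC exprM cyclotomic_p expr1n subrr.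
  rewrite -[RHS]opprB subrX1 -mulNr opprB mulr_suml mulr_sumr.
  by apply: eq_bigr => i _; rewrite mulrBl mulrBr mul1r mulr1 -exprS -exprSr.
have Spi : (S * pi = 0)%R.
  have -> : (pi = (1 - zeta ^+ e) * \sum_(i < f) (zeta ^+ e) ^+ i)%R.
    rewrite -[RHS]opprK -mulNr opprB -subrX1 opprB -exprM mulnC E exprD mulnC exprM.
    by rewrite cyclotomic_p expr1n mul1r.
  by rewrite mulrA S0 mul0r.
have [r0 Er0] := cyclotomic_pi.
have Sp : (S *+ p = 0)%R by rewrite -mulr_natr Er0 mulrA Spi mul0r.
apply/matrixP => i j; have := congr1 (fun M : 'M_m.+1 => M i j) Sp.
rewrite mulmxnE !mxE => /eqP; rewrite mulrn_eq0 eqn0Ngt p_gt0.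
by move/eqP.
Qed.

(* X * Y becomes the translation by the unit zeta ^- 1 of Z[zeta], while b is
   mapped outside the translations, hence to an element of order p. *)
Lemma cyclotomic_indep b : (dx b != dy b)%R -> indep (X * Y) b.
Proof.
move=> Db i j g h E.
pose x := letter p true; pose y := letter p false.
have zp := cyclotomic_p; have [r0 p_pi] := cyclotomic_pi.
have [||u [a [ua ul al]]] := @affine_rep_exists _ p
  (fun b => if b then zeta ^+ p.-1 else zeta)%R
  (fun b => if b then 0 else 1)%R p_gt0.
- by case=> //; rewrite -exprM mulnC exprM zp expr1n.
- by case; rewrite ?mulr0 ?mulr1.
have ul' c : exists k, u (letter p c) = (zeta ^+ k)%R.
  by rewrite ul; case: c; [exists p.-1 | exists 1%N].
(* The linear part of an element is read off from its direction. *)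
have uexp z : exists2 k, u z = (zeta ^+ k)%R &
    (k%:R = dy (coset N z) - dx (coset N z))%R.
  move: z; apply: (generates_ind_mul p_gt0 (letter_generates p));
    rewrite ?letterXp //.
  - exists 0%N; first by rewrite (rep_u1 ua).
    by rewrite gmulf1 (dir1 dxM) (dir1 dyM) subrr.
  - move=> z [k uk kE]; exists (p.-1 + k)%N.
      by rewrite (rep_uM ua) ul uk exprD.
    have p1 : (p.-1%:R = -1 :> 'F_p)%R.
      by apply/eqP; rewrite -subr_eq0 opprK natr1 prednK // Fp_p.
    by rewrite natrD p1 gmulfM dxM dyM dxX dyX kE /= add0r opprD addrCA.
  - move=> z [k uk kE]; exists k.+1; first by rewrite (rep_uM ua) ul uk exprS.
    by rewrite -add1n natrD gmulfM dxM dyM dxY dyY kE add0r addrA.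
pose w := repr b; have wE : coset N w = b by apply: coset_repr.
have [e we eE] := uexp w.
have p_e : ~~ (p %| e) by rewrite -Fp_natr_eq0 eE wE subr_eq0 eq_sym.
have uxy : u (x * y) = 1%R by rewrite (rep_uM ua) !ul -exprSr prednK.
have axy : a (x * y) = (zeta ^+ p.-1)%R.
  by rewrite (rep_aM ua) !ul !al add0r mulr1.
pose s := ((x * y) ^+ i) ^ repr g; pose t := (w ^+ j) ^ repr h.
have cE : coset N s = coset N t.
  by rewrite !gmulfJ !gmulfXn gmulfM /= !coset_repr ?wE.
have [u_st [r a_st]] := coset_rep p_gt0 ua zp ul' p_pi n_gt1 cE.
have u_s : u s = 1%R by rewrite (rep_uJ p_gt0 ua zp ul') (rep_uX ua) uxy expr1n.
have u_wj : u (w ^+ j) = 1%R.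
  by rewrite -(rep_uJ p_gt0 ua zp ul' _ (repr h)) -u_st.
(* [w] has linear part [zeta ^+ e] with [e] prime to [p], so a power of [w] that is a translation is
   a power of [w ^+ p], which acts trivially by [cyclotomic_sum]. *)
have /dvdnP[j' jE] : p %| j.
  have : p %| e * j.
    by apply: cyclotomic_dvd; rewrite exprM -we -(rep_uX ua) u_wj.
  by rewrite Euclid_dvdM // (negPf p_e).
have a_wj : a (w ^+ j) = 0%R.
  rewrite jE mulnC expgnA (rep_aX1 ua); last first.
    by rewrite (rep_uX ua) we -exprM mulnC exprM zp expr1n.
  by rewrite (rep_aX ua) we cyclotomic_sum // mul0r mul0rn.
have a_t : a t = 0%R.
  have := rep_aJ ua (repr h) u_wj; rewrite a_wj -/t.
  have [k ->] := rep_u p_gt0 ua zp ul' (repr h) => E0.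
  by rewrite -[a t]mul1r -(zeta_inv p_gt0 zp k) -mulrA E0 mulr0.
(* [t] acts trivially and [s] translates by [i] times a unit; they agree modulo [pi ^+ n.-1]. *)
have [q Eq] : exists q, (i%:R = pi ^+ n.-1 * q)%R.
  have uxyi : u ((x * y) ^+ i) = 1%R by rewrite (rep_uX ua) uxy expr1n.
  have := rep_aJ ua (repr g) uxyi; rewrite -/s (rep_aX1 ua) // axy.
  have [k ->] := rep_u p_gt0 ua zp ul' (repr g).
  have -> : (a s = pi ^+ n.-1 * - r)%R.
    by apply/eqP; rewrite mulrN -addr_eq0 -a_st a_t.
  rewrite mulrA -(pi_comm zeta) => E1.
  exists (zeta * (zeta ^+ k * - r))%R.
  have pz := pi_comm zeta n.-1 1; rewrite expr1 in pz.
  rewrite (mulrA (pi ^+ _)%R zeta) pz -mulrA (mulrA (pi ^+ _)%R) E1.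
  by rewrite mulrnAr -exprS prednK // zp.
(* Determinants are taken: [i] is a scalar matrix of size [p.-1], and [pi] has determinant [p]. *)
have p_i : p ^ n.-1 %| i ^ p.-1.
  have detX k : (\det (pi ^+ k) = p%:R ^+ k)%R.
    by elim: k => [|k IHk]; rewrite ?det1 // exprS detM IHk zeta_det -exprS.
  have := congr1 (fun M : 'M_m.+1 => `|(\det M)%R|%N) Eq.
  rewrite detM detX -(rmorph_nat (@scalar_mx int m.+1)) det_scalar.
  rewrite abszM !abszX !natz !absz_nat => E'; have -> : p.-1 = m.+1 by rewrite p_m.
  by rewrite E'; apply: dvdn_mulr.
have [->|i_gt0] := posnP i; first by [].
pose l := logn p i.
(* This is exactly the bound under which [expgpX_eq1] kills [p ^ l]-th powers. *)
have le_l : n.-1 <= l * p.-1.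
  have p1 : 0 < i ^ p.-1 by rewrite expn_gt0 i_gt0.
  by move: p_i; rewrite pfactor_dvdn // lognX mulnC.
have /dvdnP[q' ->] : p ^ l %| i by rewrite pfactor_dvdnn.
rewrite mulnC expgnA.
rewrite (@expgpX_eq1 _ p n.-1 X Y) ?expg1n //.
- exact: pq_generates.
- exact: pq_expX.
- exact: pq_expY.
- by move=> z; apply: pq_lcs; apply: ltnW.
Qed.

End CyclotomicIndependence.

Lemma pq_indep_XY b : (dx b != dy b)%R -> indep (X * Y) b.
Proof.
have [m [zeta [p_m zs zd]]] := cyclotomic_matrix p_pr.
exact: (cyclotomic_indep p_m zs zd).
Qed.

End Directions.

Section Wreath.
Import Order.TTheory GRing.Theory Num.Theory.
Variable n : nat.
Hypothesis n_gt3 : (3 < n)%N.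
Local Notation F := (free_product_cyclic 3).
Local Notation N := (pcentral F 3 n).
Local Notation z b := (letter 3 b).

(* The representation maps F onto the wreath product C_3 wr C_3, of
   nilpotency class 3, whose base group contains letter c. *)
Lemma wreath_indep (c : bool) (v : F) (M : 'M['F_3]_3) :
    (forall u a : F -> 'M['F_3]_3, affine_rep u a ->
       (forall b, u (z b) = if b == c then 1 else shift3_mx)%R ->
       (forall b, a (z b) = if b == c then 1 else 0)%R ->
     u v = 1%R /\ a v = M) ->
    (M 0 1 = 1)%R -> (M 0 2 = 1)%R ->
  indep (coset N (z c)) (coset N v).
Proof.
move=> vM M1 M2 i j g h E; have p3 : (0 < 3)%N by [].
have [||u [a [ua ul al]]] := @affine_rep_exists _ 3
  (fun b => if b == c then 1 else shift3_mx)%R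
  (fun b => if b == c then 1 else 0)%R isT.
- by move=> b; case: ifP => _; rewrite ?expr1n ?shift3_mx3.
- move=> b; case: ifP => _; rewrite ?mulr0 // mulr1.
  under eq_bigr do rewrite expr1n.
  by rewrite sumr_const card_ord F3_mulrn3.
have [uv av] := vM u a ua ul al.
have ul' b : exists k, u (z b) = (shift3_mx ^+ k)%R.
  by rewrite ul; case: ifP; [exists 0%N | exists 1%N].
have p_pi : (3%:R = (1 - shift3_mx) * 0)%R by rewrite mulr0 F3_mulrn3.
pose s := ((z c) ^+ i) ^ repr g; pose t := (v ^+ j) ^ repr h.
have cE : coset N s = coset N t.
  by rewrite !gmulfJ !gmulfXn /= !coset_repr.
have [_ [r a_st]] := coset_rep p3 ua shift3_mx3 ul' p_pi (ltnW (ltnW n_gt3)) cE.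
have {r}a_st : a s = a t.
  (* For [n >= 4] the error term is a multiple of the vanishing cube, so the coset determines the
     translation exactly. *)
  rewrite a_st -(subnKC n_gt3) /= exprD shift3_mx_nilp mul0r mul0r.
  by rewrite addr0.
have uX w k : u w = 1%R -> u (w ^+ k) = 1%R.
  by move=> uw; rewrite (rep_uX ua) uw expr1n.
have uc : u (z c) = 1%R by rewrite ul eqxx.
have [k uk] := rep_u p3 ua shift3_mx3 ul' (repr g).
have [l ul_] := rep_u p3 ua shift3_mx3 ul' (repr h).
have as_ := rep_aJ ua (repr g) (uX _ i uc).
have at_ := rep_aJ ua (repr h) (uX _ j uv).
rewrite -/s -/t uk ul_ !(rep_aX1 ua) // al eqxx av a_st in as_ at_.
(* Both conjugations are undone; [2 * k] is the exponent of the inverse of [shift3_mx ^+ k]. *)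
have : (shift3_mx ^+ (l + 2 * k) *+ i = M *+ j)%R.
  rewrite -at_ exprD -mulr_natr -as_ -!mulrA; congr (_ * _)%R.
  by rewrite mulrA (zeta_inv p3 shift3_mx3 k) mul1r.
move/(shift3_mx_multiple M1 M2)/dvdnP=> [q ->].
by rewrite -gmulfXn mulnC expgnA letterXp expg1n gmulf1.
Qed.

End Wreath.

(** * Beauville structures *)

Section Beauville.
Import Order.TTheory GRing.Theory Num.Theory.
Variables (p n : nat).
Hypotheses (p_pr : prime p) (n_gt1 : (1 < n)%N).
Local Notation F := (free_product_cyclic p).
Local Notation N := (pcentral F p n).
Local Notation G := (quotient_group N).
Local Notation X := (coset N (letter p true)).
Local Notation Y := (coset N (letter p false)).

Let n_gt0 : (0 < n)%N. Proof. exact: ltnW. Qed.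

Variables dx dy : G -> 'F_p.
Hypothesis dxM : forall a b, dx (a * b) = (dx a + dx b)%R.
Hypothesis dyM : forall a b, dy (a * b) = (dy a + dy b)%R.
Hypotheses (dxX : dx X = 1%R) (dxY : dx Y = 0%R).
Hypotheses (dyX : dy X = 0%R) (dyY : dy Y = 1%R).

Lemma pq_generates_gen (A : set G) : gen A X -> gen A Y -> generates A.
Proof.
move=> gX gY; apply/seteqP; split=> // a _.
apply: (gen_subP (subgroup_gen A) _ (_ : gen [set X; Y] a)).
  by move=> _ [] ->.
by have := pq_generates p n; rewrite /generates => ->.
Qed.

Lemma pq_exponent (w : G) : w ^+ (p ^ n.-1) = 1.
Proof.
apply: (expgpX_eq1 p_pr (pq_generates p n) (pq_expX p n) (pq_expY p n)
    (pq_lcs n_gt0)).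
by rewrite leq_pmulr // -subn1 subn_gt0 prime_gt1.
Qed.

Lemma beauville_indep (a b : G) : generates [set a; b] ->
  {in [:: X; Y; X * Y] & [:: a; b; a * b], forall w v, indep w v} -> beauville G.
Proof.
move=> gab ind; split.
- exact: (nilpotent_finite p_pr (pq_generates p n) (pq_expX p n) (pq_expY p n)
    (pq_lcs n_gt0)).
- exact: (pq_min_generators dxM dyM dxX dxY dyX dyY).
exists X, Y, a, b; split=> //; first exact: pq_generates.
apply: (@Sigma_disjoint _ (p ^ n.-1)) => // [|w]; last exact: pq_exponent.
by rewrite expn_gt0 prime_gt0.
Qed.

Lemma indepX v : dy v != 0%R -> indep X v.
Proof.
move=> dv; apply: (indep_dir p_pr dxM dyM); first exact: pq_expX.
by rewrite dxX dyX mul1r mulr0.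
Qed.

Lemma indepY v : dx v != 0%R -> indep Y v.
Proof.
move=> dv; apply: (indep_dir p_pr dxM dyM); first exact: pq_expY.
by rewrite dxY dyY mul0r mulr1 eq_sym.
Qed.

Lemma indepXY v : dx v != dy v -> indep (X * Y) v.
Proof. exact: (pq_indep_XY p_pr n_gt1 dxM dyM dxX dxY dyX dyY). Qed.

Definition dirE := (dxM, dyM, dirX dxM, dirX dyM, dxX, dxY, dyX, dyY).

(** The non-divisibilities say that the direction of [v] is parallel to none of (1,0), (0,1),
    (1,1). *)
Lemma indep_nat v k l : dx v = (k%:R)%R -> dy v = (l%:R)%R ->
    ~~ (p %| k) -> ~~ (p %| l) -> (k <= l)%N -> ~~ (p %| l - k) ->
  {in [:: X; Y; X * Y], forall w, indep w v}.
Proof.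
move=> xv yv pk pl le_kl pkl w; rewrite !inE => /or3P[] /eqP ->.
- by apply: indepX; rewrite yv Fp_natr_eq0.
- by apply: indepY; rewrite xv Fp_natr_eq0.
by apply: indepXY; rewrite xv yv eq_sym -subr_eq0 -natrB // Fp_natr_eq0.
Qed.

Lemma beauville_ge5 : (5 <= p)%N -> beauville G.
Proof.
move=> p_ge5.
apply: (@beauville_indep (X * Y ^+ 2) (X * Y ^+ 4)).
  set A := [set _; _]; have sA := subgroup_gen A.
  have gA1 : gen A (X * Y ^+ 2) by apply: (@sub_gen _ A); left.
  have gA2 : gen A (X * Y ^+ 4) by apply: (@sub_gen _ A); right.
  have gY2 : gen A (Y ^+ 2).
    have -> : Y ^+ 2 = (X * Y ^+ 2)^-1 * (X * Y ^+ 4).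
      by rewrite invgM -mulgA mulKg -[4]/(2 + 2)%N expgnDr mulKg.
    by apply: (subgroupM sA) => //; apply: (subgroupV sA).
  apply: pq_generates_gen.
    rewrite -[X](mulgK (Y ^+ 2)).
    by apply: (subgroupM sA) => //; apply: (subgroupV sA).
  have p_odd : odd p by have := even_prime p_pr; case=> // p2; rewrite p2 in p_ge5.
  (* Since [p] is odd, 2 is invertible modulo the order of [Y]. *)
  have -> : Y = (Y ^+ 2) ^+ p.+1./2.
    by rewrite -expgnA mulnC muln2 even_halfK /= ?p_odd // expgS pq_expY mulg1.
  exact: (@subgroupX _ _ _ _ sA).
(* The new triple has directions (1,2), (1,4), (2,6); their entries and differences are 1, 2, 3, 4
   and 6. *)
have ndvd k : (0 < k <= 6)%N -> (k != 5)%N -> ~~ (p %| k).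
  case/andP=> k0 k6 k5; apply/negP => pk; have le_pk := dvdn_leq k0 pk.
  have [p5|p6] : p = 5 \/ p = 6 by lia.
    by move: k0 k5 le_pk k6 pk; rewrite p5; case: k => [|[|[|[|[|[|[|]]]]]]].
  by move: p_pr; rewrite p6.
move=> w v w1; rewrite !inE => /or3P[] /eqP ->.
- apply: (@indep_nat _ 1 2) w1; rewrite ?dirE ?mul0rn ?addr0 ?add0r //;
    exact: ndvd.
- apply: (@indep_nat _ 1 4) w1; rewrite ?dirE ?mul0rn ?addr0 ?add0r //;
    exact: ndvd.
apply: (@indep_nat _ 2 6) w1;
  rewrite ?dirE ?mul0rn ?addr0 ?add0r -?mulrnDr //; exact: ndvd.
Qed.

Lemma not_beauville_common : (forall a1 b1 a2 b2 : G,
    generates [set a1; b1] -> generates [set a2; b2] -> exists w,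
    [/\ w != 1, Sigma a1 b1 w & Sigma a2 b2 w]) -> ~ beauville G.
Proof.
move=> common [_ _ [a1 [b1 [a2 [b2 [g1 g2 S12]]]]]].
have [w [w1 Sw1 Sw2]] := common _ _ _ _ g1 g2.
have : (Sigma a1 b1 `&` Sigma a2 b2) w by [].
by rewrite S12 => /eqP; rewrite (negPf w1).
Qed.

(** For [p = 2] the group is generated by two involutions and [r = X * Y] plays the rotation. The
    directions force [z = r ^+ k * X] with [k] even, a conjugate of [X] by [r ^- (k / 2)]. *)
Lemma dihedral_conj z : p = 2 -> dx z = 1%R -> dy z = 0%R -> exists g, z = X ^ g.
Proof.
move=> p2; pose r := X * Y.
have XX : X * X = 1 by rewrite -expg2 -p2 pq_expX.
have YY : Y * Y = 1 by rewrite -expg2 -p2 pq_expY.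
have Xr k : X * r ^+ k = r ^- k * X.
  have rX : r ^ X = r^-1.
    by rewrite /r /conjg invgM (mulg1_eq XX) (mulg1_eq YY) !mulgA XX mul1g.
  have := conjXg r X k; rewrite rX expVgn => <-.
  by rewrite /conjg (mulg1_eq XX) -!mulgA XX mulg1.
have [k [e ->]] : exists k (e : bool), z = r ^+ k * X ^+ e.
  have p_gt0 := prime_gt0 p_pr.
  have HX w : (exists k (e : bool), w = r ^+ k * X ^+ e) ->
      exists k (e : bool), X * w = r ^+ k * X ^+ e.
    move=> [k [e ->]]; exists ((p ^ n.-1).-1 * k)%N, (~~ e).
    rewrite expg_predp ?pq_exponent ?expn_gt0 ?p_gt0 // mulgA Xr -mulgA.
    by case: e; rewrite /= ?expg1 ?XX ?mulg1.
  move: z; apply: (generates_ind_mul p_gt0 (pq_generates p n)).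
  - exact: pq_expX.
  - exact: pq_expY.
  - by exists 0%N, false; rewrite mulg1.
  - exact: HX.
  - move=> w [k [e ->]].
    have -> : Y * (r ^+ k * X ^+ e) = X * (r ^+ k.+1 * X ^+ e).
      by rewrite expgS /r !mulgA XX mul1g.
    by apply: HX; exists k.+1, e.
have [xr yr] : dx (r ^+ k) = (k%:R)%R /\ dy (r ^+ k) = (k%:R)%R.
  by rewrite (dirX dxM) (dirX dyM) /r !dirE addr0 add0r.
rewrite dxM dyM xr yr !dirE mul0rn addr0 => + k0; rewrite k0 add0r.
case: e => [_|/eqP]; last by rewrite eq_sym oner_eq0.
move/eqP: k0; rewrite Fp_natr_eq0 // => /dvdnP[m ->].
rewrite [in (_ * p)%N]p2 muln2 -addnn expgnDr expg1; exists (r ^- m).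
have q_gt0 : (0 < p ^ n.-1)%N by rewrite expn_gt0 prime_gt0.
rewrite -(expg_predp q_gt0 m (pq_exponent r)) /conjg Xr.
by rewrite (expg_predp q_gt0 m (pq_exponent r)) invgK mulgA.
Qed.

(** There are three nonzero directions over ['F_2], and every generating triple takes them all, so
    it contains a conjugate of [X]. *)
Lemma not_beauville_2 : p = 2 -> ~ beauville G.
Proof.
move=> p2; apply: not_beauville_common => a1 b1 a2 b2 g1 g2; exists X.
have F2 (e : 'F_p) : e != 0%R -> e = 1%R.
  have : ((e : nat) < 2)%N.
    by rewrite -p2; apply: leq_trans (ltn_ord e) _; rewrite Fp_cast.
  move=> e2 e0; apply/val_inj => /=; rewrite modn_small //.
  have : (e : nat) <> 0%N by move=> E; case/negP: e0; apply/eqP/val_inj.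
  by case: (e : nat) e2 => [|[|]].
have SX a b : generates [set a; b] -> Sigma a b X.
  move/(generates_det dxM dyM dxX dxY dyX dyY) => D.
  suffices [w wab [xw yw]] : exists2 w, w \in [:: a; b; a * b] &
      dx w = 1%R /\ dy w = 0%R.
    have [g wE] := dihedral_conj p2 xw yw.
    have -> : X = (w ^+ 1) ^ g^-1 by rewrite wE conjgK.
    exact: mem_Sigma.
  have [ya|/F2 ya] := eqVneq (dy a) 0%R.
    exists a; rewrite ?inE ?eqxx //; split=> //; apply: F2.
    by apply: contraNneq D => ->; rewrite ya mul0r mulr0.
  have [yb|/F2 yb] := eqVneq (dy b) 0%R.
    exists b; rewrite ?inE ?eqxx ?orbT //; split=> //; apply: F2.
    by apply: contraNneq D => ->; rewrite yb mul0r mulr0.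
  exists (a * b); rewrite ?inE ?eqxx ?orbT //.
  have two0 : (1 + 1 = 0 :> 'F_p)%R by rewrite -mulr2n -p2 Fp_p.
  rewrite dxM dyM ya yb two0; split=> //.
  apply: F2; rewrite ya yb !mulr1 in D; apply: contraNneq D => /eqP.
  rewrite addr_eq0 => /eqP ->.
  by rewrite eq_sym -addr_eq0 -[dx b]mulr1 -mulrDr two0 mulr0.
split; [|exact: SX|exact: SX].
by apply/eqP => X1; move/eqP: dxX; rewrite X1 (dir1 dxM) eq_sym oner_eq0.
Qed.

Lemma pq_normal_form z : exists i j (c : G),
  lcs 1 c /\ z = X ^+ i * Y ^+ j * c.
Proof.
move: z; apply: (generates_ind_mul (prime_gt0 p_pr) (pq_generates p n)
  (pq_expX p n) (pq_expY p n)).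
- exists 0%N, 0%N, 1; rewrite !mulg1; split=> //.
  exact: (subgroup1 (lcs_subgroup _ _)).
- by move=> z [i [j [c [Lc ->]]]]; exists i.+1, j, c; rewrite expgS !mulgA.
move=> z [i [j [c [Lc ->]]]]; exists i, j.+1, ([~ Y, X ^+ i] ^ (Y ^+ j) * c).
have sL := @lcs_subgroup G 1; split.
  by apply: (subgroupM sL) => //; apply: lcsJ; apply: lcsS_R.
by rewrite !mulgA (commgC Y) expgS /conjg !gnorm.
Qed.

Lemma dir_lcs1 (c : G) : lcs 1 c -> dx c = 0%R /\ dy c = 0%R.
Proof.
move: c; apply: (@lcsS_ind _ _ [set c | dx c = 0%R /\ dy c = 0%R]).
  apply/subgroupP; split=> [|a b [xa ya] [xb yb]].
    by rewrite /= (dir1 dxM) (dir1 dyM).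
  by rewrite /= dxM dyM (dirV dxM) (dirV dyM) xa ya xb yb subr0.
move=> a g _; rewrite /= commgEl dxM dyM (dirV dxM) (dirV dyM).
by rewrite (dirJ dxM) (dirJ dyM) !addNr.
Qed.

Lemma dir_normal_form i j c : lcs 1 c ->
  dx (X ^+ i * Y ^+ j * c) = (i%:R)%R /\ dy (X ^+ i * Y ^+ j * c) = (j%:R)%R.
Proof.
by move/dir_lcs1=> [xc yc]; rewrite !dirE xc yc !mul0rn !addr0 add0r.
Qed.

Lemma expg_dvd (w : G) k : w ^+ p = 1 -> p %| k -> w ^+ k = 1.
Proof. by move=> wp /dvdnP[q ->]; rewrite mulnC expgnA wp expg1n. Qed.

(** In the normal form both exponents are divisible by [p], which leaves only the factor in the
    derived subgroup. *)
Lemma dir0_lcs1 z : dx z = 0%R -> dy z = 0%R -> lcs 1 z.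
Proof.
have [i [j [c [Lc ->]]]] := pq_normal_form z.
have [-> ->] := dir_normal_form i j Lc => /eqP + /eqP.
rewrite !Fp_natr_eq0 // => pi pj.
by rewrite (expg_dvd (pq_expX p n) pi) (expg_dvd (pq_expY p n) pj) !mul1g.
Qed.

(** * Conjugacy in nilpotency class two *)

Section ClassTwo.
Hypothesis lcs2 : forall c : G, lcs 2 c -> c = 1.

Lemma class2_commute (c g : G) : lcs 1 c -> commute c g.
Proof. by move=> Lc; apply/commgP/eqP/lcs2; apply: lcsS_R. Qed.

Lemma class2_Jfix (c g : G) : lcs 1 c -> c ^ g = c.
Proof. by move=> /class2_commute cg; rewrite /conjg cg mulKg. Qed.

Lemma lcs1_commg (a g : G) : lcs 1 [~ a, g].
Proof. exact: lcsS_R. Qed.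

Lemma class2_commMg (a b g : G) : [~ a * b, g] = [~ a, g] * [~ b, g].
Proof. by rewrite commMgJ class2_Jfix //; apply: lcs1_commg. Qed.

Lemma class2_commXg (a g : G) k : [~ a ^+ k, g] = [~ a, g] ^+ k.
Proof.
elim: k => [|k IHk]; first by rewrite comm1g.
by rewrite !expgS class2_commMg IHk.
Qed.

(** In class two [g |-> [~ z, g]] is a homomorphism with central values. Its image contains
    [[~ X, Y]], which generates the derived subgroup, hence contains [z^-1 * w]. *)
Lemma class2_conj (z w : G) : dx z = dx w -> dy z = dy w ->
  dx z != 0%R \/ dy z != 0%R -> exists g, z ^ g = w.
Proof.
move=> xzw yzw nz; pose Im : set G := [set c | exists g, [~ z, g] = c].
suffices /(_ (z^-1 * w))[|g Eg] : forall c, lcs 1 c -> Im c.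
  - by apply: dir0_lcs1; rewrite !dirE (dirV dxM, dirV dyM) ?xzw ?yzw addNr.
  - by exists g; rewrite conjg_mulR Eg mulVKg.
have sIm : is_subgroup Im.
  apply/subgroupP; split=> [|_ _ [g <-] [h <-]]; first by exists 1; rewrite commg1.
  have LV : lcs 1 [~ z, h]^-1.
    exact: (subgroupV (@lcs_subgroup G 1) (lcs1_commg _ _)).
  by exists (h^-1 * g); rewrite commgMJ commgVJ !class2_Jfix.
pose t := [~ X, Y].
have tp : t ^+ p = 1 by rewrite -class2_commXg pq_expX comm1g.
have tIm : Im t.
  have tX k : ~~ (p %| k) -> Im (t ^+ k) -> Im t.
    rewrite -prime_coprime // coprime_sym => co_kp Imk.
    have k_gt0 : (0 < k)%N.
      case: k {Imk} co_kp => //; rewrite /coprime gcd0n => /eqP p1.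
      by move: p_pr; rewrite p1.
    case: (egcdnP p k_gt0) => f g Efg _; rewrite (eqP co_kp) in Efg.
    have : Im (t ^+ k ^+ f) by apply: (@subgroupX _ _ _ _ sIm).
    by rewrite -expgnA mulnC Efg expgnDr mulnC expgnA tp expg1n mul1g.
  (* For [z = X ^+ i * Y ^+ j * c] the commutators with [Y] and [X] are [t ^+ i] and [t ^- j], and
     [p] fails to divide one of the exponents. *)
  have [i [j [c [Lc zE]]]] := pq_normal_form z.
  have [xz yz] := dir_normal_form i j Lc; rewrite -zE in xz yz.
  have cg g : [~ c, g] = 1 by apply/eqP/commgP; apply: class2_commute.
  case: nz; rewrite ?xz ?yz Fp_natr_eq0 // => /tX; apply.
    exists Y; rewrite zE !class2_commMg !class2_commXg cg commgg expg1n !mulg1.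
    by [].
  rewrite -[t ^+ j]invgK; apply: (subgroupV sIm); exists X.
  rewrite zE !class2_commMg !class2_commXg cg commgg expg1n mul1g mulg1.
  by rewrite -invgR expVgn.
have tVIm : Im [~ Y, X] by rewrite -invgR; apply: (subgroupV sIm).
have Im1 : Im 1 := subgroup1 sIm.
have ImR g (a : G) : Im [~ X, g] -> Im [~ Y, g] -> Im [~ a, g].
  move=> ImX ImY; move: a; apply: (generates_ind (pq_generates p n)).
    apply/subgroupP; split=> [|a b Ia Ib] /=; first by rewrite comm1g.
    rewrite class2_commMg commVgJ class2_Jfix.
      by apply: (subgroupM sIm) => //; apply: (subgroupV sIm).
    exact: (subgroupV (@lcs_subgroup G 1) (lcs1_commg _ _)).
  by move=> _ [] ->.
apply: (lcsS_ind sIm) => a g _; move: g; apply: (generates_ind (pq_generates p n)).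
  apply/subgroupP; split=> [|g h Ig Ih] /=; first by rewrite commg1.
  rewrite commgMJ commgVJ !class2_Jfix.
  - by apply: (subgroupM sIm) => //; apply: (subgroupV sIm).
  - exact: lcs1_commg.
  - exact: (subgroupV (@lcs_subgroup G 1) (lcs1_commg _ _)).
by move=> _ [] ->; apply: ImR; rewrite ?commgg.
Qed.

End ClassTwo.

End Beauville.

Section PrimeThree.
Import Order.TTheory GRing.Theory Num.Theory.
Local Open Scope ring_scope.

Definition add2 (a b : 'F_3 * 'F_3) : 'F_3 * 'F_3 := (a.1 + b.1, a.2 + b.2).

(** The projective line over ['F_3] has four points and each triple occupies three, so two triples
    meet; the nonzero scalars are 1 and 2. Checked by enumeration. *)
Lemma F3_common_direction (a b c d : 'F_3 * 'F_3) :
    a.1 * b.2 != b.1 * a.2 -> c.1 * d.2 != d.1 * c.2 ->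
  exists2 u, u \in [:: a; b; add2 a b] &
  exists2 v, v \in [:: c; d; add2 c d] & u = v \/ u = add2 v v.
Proof.
pose s3 : seq 'F_3 := [:: 0; 1; 2%:R].
pose s9 := [seq (x, y) | x <- s3, y <- s3].
have s9P e : e \in s9.
  case: e => x y; apply: allpairs_f.
    by case: x => -[|[|[|]]] // lt; rewrite !inE -!val_eqE.
  by case: y => -[|[|[|]]] // lt; rewrite !inE -!val_eqE.
move=> nab ncd.
pose ok a b c d : bool := (a.1 * b.2 != b.1 * a.2) ==> (c.1 * d.2 != d.1 * c.2) ==>
  has (fun u => has (fun v => (u == v) || (u == add2 v v)) [:: c; d; add2 c d])
    [:: a; b; add2 a b].
have /allP/(_ _ (s9P a))/allP/(_ _ (s9P b))/allP/(_ _ (s9P c))/allP/(_ _ (s9P d)) :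
    all (fun a => all (fun b => all (fun c => all (ok a b c) s9) s9) s9) s9.
  by vm_compute.
rewrite /ok nab ncd => /hasP[u u1 /hasP[v v1 uv]].
by exists u => //; exists v => //; case/orP: uv => /eqP ->; [left | right].
Qed.

End PrimeThree.

Section Three.
Import Order.TTheory GRing.Theory Num.Theory.
Variable n : nat.
Hypothesis n_gt1 : (1 < n)%N.
Local Notation F := (free_product_cyclic 3).
Local Notation N := (pcentral F 3 n).
Local Notation G := (quotient_group N).
Local Notation X := (coset N (letter 3 true)).
Local Notation Y := (coset N (letter 3 false)).

Let p_pr : prime 3. Proof. by []. Qed.

Variables dx dy : G -> 'F_3.
Hypothesis dxM : forall a b, dx (a * b) = (dx a + dx b)%R.
Hypothesis dyM : forall a b, dy (a * b) = (dy a + dy b)%R.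
Hypotheses (dxX : dx X = 1%R) (dxY : dx Y = 0%R).
Hypotheses (dyX : dy X = 0%R) (dyY : dy Y = 1%R).

Lemma beauville_3 : (3 < n)%N -> beauville G.
Proof.
move=> n_gt3; pose v2 := Y * (X * Y) ^+ 2; pose v3 := Y * (X * Y) ^+ 3.
have v3E : v3 = v2 * (X * Y) by rewrite /v3 expgSr mulgA.
have iX : indep X v2.
  have -> : v2 = coset N (letter 3 false * (letter 3 true * letter 3 false) ^+ 2).
    by rewrite gmulfM gmulfXn gmulfM.
  (* The translation by which [Y * (X * Y) ^+ 2] acts when [X] is translation by 1 and [Y] is the
     shift. *)
  apply: (@wreath_indep _ n_gt3 _ _ (shift3_mx ^+ 1 + shift3_mx ^+ 2)%R).
  - move=> u a [u1 uM aM] ul al; rewrite expg2 !(uM, aM) !ul !al /=.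
    rewrite !mulr0 !addr0 !add0r !mulr1 !mul1r mulrDr mulr1 -expr2 expr1.
    by rewrite -exprS shift3_mx3.
  - by rewrite mxE !shift3_mx_row; apply/eqP.
  - by rewrite mxE !shift3_mx_row; apply/eqP.
have iY : indep Y v3.
  have -> : v3 = coset N (letter 3 false * (letter 3 true * letter 3 false) ^+ 3).
    by rewrite gmulfM gmulfXn gmulfM.
  (* The same with the roles of [X] and [Y] exchanged; the outer terms coincide, as the shift has
     order 3. *)
  apply: (@wreath_indep _ n_gt3 _ _
    (shift3_mx ^+ 0 + (shift3_mx ^+ 1 + (shift3_mx ^+ 2 + shift3_mx ^+ 3)))%R).
  - move=> u a [u1 uM aM] ul al; rewrite !expgS expg0 mulg1 !(uM, aM) !ul !al /=.
    have z3 := shift3_mx3; rewrite !exprS expr0 mulr1 in z3.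
    by rewrite !mulr1 !add0r !mul1r !mulrDr !exprS expr0 !mulr1 z3.
  - by rewrite mxE shift3_mx_row mxE shift3_mx_row mxE !shift3_mx_row; apply/eqP.
  - by rewrite mxE shift3_mx_row mxE shift3_mx_row mxE !shift3_mx_row; apply/eqP.
have [x2 y2] : dx v2 = (- 1)%R /\ dy v2 = 0%R.
  rewrite /v2 expg2 !dxM !dyM dxX dxY dyX dyY.
  by split; apply/eqP.
have [x3 y3] : dx v3 = 0%R /\ dy v3 = 1%R.
  rewrite v3E (dxM v2) (dyM v2) x2 y2 (dxM X) (dyM X) dxX dxY dyX dyY.
  by split; apply/eqP.
have iY' := indepY p_pr dxM dyM dxY dyY; have iX' := indepX p_pr dxM dyM dxX dyX.
have iXY' := indepXY p_pr n_gt1 dxM dyM dxX dxY dyX dyY.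
apply: (@beauville_indep _ n p_pr n_gt1 dx dy dxM dyM dxX dxY dyX dyY v2 v3).
  set A := [set _; _]; have sA := subgroup_gen A.
  have gA2 : gen A v2 by apply: (@sub_gen _ A); left.
  have gA3 : gen A v3 by apply: (@sub_gen _ A); right.
  have gXY : gen A (X * Y).
    have -> : X * Y = v2^-1 * v3 by rewrite v3E mulKg.
    by apply: (subgroupM sA) => //; apply: (subgroupV sA).
  have gY : gen A Y.
    have -> : Y = v2 * ((X * Y) ^+ 2)^-1 by rewrite mulgK.
    apply: (subgroupM sA) => //; apply: (subgroupV sA).
    exact: (@subgroupX _ _ _ _ sA).
  apply: pq_generates_gen => //; rewrite -[X](mulgK Y).
  by apply: (subgroupM sA) => //; apply: (subgroupV sA).
have x23 : dx (v2 * v3) = (- 1)%R by rewrite (dxM v2) x2 x3 addr0.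
have y23 : dy (v2 * v3) = 1%R by rewrite (dyM v2) y2 y3 add0r.
(* The new triple has directions (-1,0), (0,1), (-1,1). Only the pairs [X], [v2] and [Y], [v3] are
   parallel, settled by [iX] and [iY]; the seven others differ in direction. *)
move=> w v; rewrite !inE => /or3P[] /eqP -> /or3P[] /eqP -> //.
- by apply: iX'; rewrite y3.
- by apply: iX'; rewrite y23.
- by apply: iY'; rewrite x2.
- by apply: iY'; rewrite x23.
- by apply: iXY'; rewrite x2 y2.
- by apply: iXY'; rewrite x3 y3.
- by apply: iXY'; rewrite x23 y23.
Qed.

(** Two generating triples share a direction up to a scalar, realised by a power [t ^+ k]; as the
    class is at most two, [class2_conj] turns equal directions into conjugacy. *)
Lemma not_beauville_3 : (n < 4)%N -> ~ beauville G.
Proof.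
move=> n_lt4; apply: not_beauville_common => a1 b1 a2 b2 g1 g2.
have det a b := @generates_det 3 n dx dy dxM dyM dxX dxY dyX dyY a b.
have lcs2 (c : G) : lcs 2 c -> c = 1.
  move=> L2; apply: (pq_lcs (ltnW n_gt1)); apply: lcs_leq L2; lia.
pose D (c : G) := (dx c, dy c).
have DM c d : D (c * d) = ((D c).1 + (D d).1, (D c).2 + (D d).2)%R.
  by rewrite /D dxM dyM.
have [u u1 [v v2 uv]] := F3_common_direction
  (a := D a1) (b := D b1) (c := D a2) (d := D b2) (det _ _ g1) (det _ _ g2).
have TD a b e : e \in [:: D a; D b; ((D a).1 + (D b).1, (D a).2 + (D b).2)%R] ->
    exists2 w, w \in [:: a; b; a * b] & D w = e.
  by rewrite !inE => /or3P[] /eqP ->; [exists a | exists b | exists (a * b)];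
    rewrite ?DM ?inE ?eqxx ?orbT.
have {u1}[w w1 wE] := TD _ _ _ u1; have {v2}[t t2 tE] := TD _ _ _ v2.
have [k wk] : exists k, D w = D (t ^+ k).
  rewrite wE; case: uv => ->; first by exists 1%N; rewrite expg1.
  by exists 2; rewrite expg2 DM tE.
have nz : dx w != 0%R \/ dy w != 0%R.
  apply/orP; rewrite -negb_and.
  apply: contraNN (det _ _ g1) => /andP[/eqP xw /eqP yw].
  move: w1; rewrite !inE => /or3P[] /eqP wE'; move: xw yw; rewrite wE'.
  - by move=> -> ->; rewrite mul0r mulr0.
  - by move=> -> ->; rewrite mul0r mulr0.
  rewrite dxM dyM => /eqP; rewrite addr_eq0 => /eqP -> /eqP.
  by rewrite addr_eq0 => /eqP ->; rewrite mulrN mulNr.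
have [xwk ywk] : dx w = dx (t ^+ k) /\ dy w = dy (t ^+ k) by case: wk.
have [g wg] := class2_conj p_pr dxM dyM dxX dxY dyX dyY lcs2 xwk ywk nz.
exists (w ^ g); split.
- rewrite conjg_eq1; apply/eqP => w10; move: nz.
  by rewrite w10 (dir1 dxM) (dir1 dyM) eqxx; case.
- by rewrite -[w]expg1; apply: mem_Sigma.
- by rewrite wg -[t ^+ k]conjg1; apply: mem_Sigma.
Qed.

End Three.

Theorem theoremB (p n : nat) (p_prime : prime p) (n_ge1 : 1 <= n) :
  beauville (quotient_group (pcentral (free_product_cyclic p) p n)) <->
  (5 <= p /\ 2 <= n) \/ (p = 3 /\ 4 <= n).
Proof.
have [n1|n_gt1] : n = 1%N \/ (1 < n)%N by lia.
  (* For [n = 1] the quotient is trivial, so the empty list generates it and the minimal number of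
     generators is not 2. *)
  subst n; split=> [[_ [_ min] _]|]; last by case=> -[].
  have /min : generates
      [set` [::] : seq (quotient_group (pcentral (free_product_cyclic p) p 1))].
    apply/seteqP; split=> // a _; rewrite (@pq_lcs p 1 isT a I).
    exact: (subgroup1 (subgroup_gen _)).
  by [].
have [dx [dxM dxX dxY]] := direction_exists p_prime n_gt1 1%R 0%R.
have [dy [dyM dyX dyY]] := direction_exists p_prime n_gt1 0%R 1%R.
split=> [B|]; last first.
  case=> -[p_eq n_eq].
    exact: (beauville_ge5 p_prime n_gt1 dxM dyM dxX dxY dyX dyY).
  subst p; exact: (beauville_3 n_gt1 dxM dyM dxX dxY dyX dyY).
have [p2|p_gt2] : p = 2 \/ 2 < p by have := prime_gt1 p_prime; lia.
  by case: (not_beauville_2 p_prime n_gt1 dxM dyM dxX dxY dyX dyY p2 B).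
have [p3|p_gt3] : p = 3 \/ 3 < p by lia.
  right; split=> //; rewrite leqNgt; apply/negP => n_lt4.
  subst p; exact: (not_beauville_3 n_gt1 dxM dyM dxX dxY dyX dyY n_lt4 B).
left; split=> //; have : p <> 4 by move=> p4; move: p_prime; rewrite p4.
by lia.
Qed.
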